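(* Let $p\in[1,\infty]$. Suppose $\sup_{f\in\mathcal F}\|f\|_\infty<\infty$ and, for each $n$, there exist: (i) a partition $\mathcal P_n=\{B_1,\dots,B_{M_n}\}$ of $N_n$ with $\max_m|B_m|\le q_n$, and an associated $r_n$-coloring $\mathcal C_{r_n}[\mathcal P_n]$; (ii) a finite partition $T_{L_n}$ of $\mathcal F$ with $|T_{L_n}|\le2^{2^{L_n}}$; such that, for some $a,b\ge1$, $$\Big(\frac{\sqrt{K_{r_n}}}{\sqrt n}\max_{m\in[M_n]}\Gamma_p(B_m)\Big)2^{\lceil aL_n\rceil/2}\to0,\qquad\Big(\frac{K_{r_n}q_n}{n}+\bar\tau_{\operatorname{cone}\Pi[T_{L_n}]}\big(\mathcal P_n,\mathcal C_{r_n}[\mathcal P_n]\big)\Big)2^{\lceil bL_n\rceil}\to0,$$ and $$\frac1n\sum_{i\in N_n}\mathbb E\Big[\sup_{C\in T_{L_n}}D_C(Z_i)\Big]\to0$$ as $n\to\infty$. Then $(\mathcal F,\mathfrak G_n)$ is graph Glivenko--Cantelli, i.e. $$\sup_{f\in\mathcal F}\Big|\frac1n\sum_{i\in N_n}\{f(Z_i)-\mathbb E[f(Z_i)]\}\Big|=o_{\mathbb P}(1).$$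
   Context: Setup. For each $n$, $\mathfrak G_n=(N_n,V_n)$ is a finite graph with $|N_n|=n$; $d_n(i,j)$ is the shortest-path distance ($+\infty$ if no path exists, $d_n(i,i)=0$), $d_n(A,B)=\inf_{i\in A,j\in B}d_n(i,j)$. $(Z_i)_{i\in N_n}$ are random elements with values in a Polish space $(\mathsf Z,\mathcal Z)$ (probability $\mathbb P$, expectation $\mathbb E$). For disjoint $A,B\subseteq N_n$ with $d_n(A,B)=+\infty$, $\sigma(Z_i:i\in A)$ and $\sigma(Z_j:j\in B)$ are independent. $\mathcal F\ni0$ is a class of real-valued measurable functions on $\mathsf Z$. $[M]=\{1,\dots,M\}$; $Z_B=(Z_i)_{i\in B}$; $\mathcal F-\mathcal F=\{f-g:f,g\in\mathcal F\}$; for a class $\mathcal B$, $\operatorname{cone}\mathcal B=\{\lambda f:f\in\mathcal B,\lambda>0,\|\lambda f\|_\infty\le1\}$. Partitions of $\mathcal F$. Each $L_n$ is a nonnegative integer. For a finite partition $T_L$ of $\mathcal F$, $\Pi[T_L]=(\pi_C)_{C\in T_L}$ is a class of representatives, one element $\pi_C\in C$ for each cell $C$, and $D_C(z)=\sup_{f_1,f_2\in C}|f_1(z)-f_2(z)|$ is the diameter function of $C\in T_L$. Colorings. For a partition $\mathcal P_M=\{B_1,\dots,B_M\}$ of $N_n$, a proper $r$-coloring is a map $c:[M]\to\mathbb N$ such that $c(m)=c(m')$, $m\ne m'$ imply $d_n(B_m,B_{m'})>r$. $K_r=K_r(\mathcal P_M)$ is the smallest possible number of distinct colors over all proper $r$-colorings;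 the coloring is taken with colors labelled by $[K_r]$, and $\mathcal C_r[\mathcal P_M]$ is the collection of its color classes $C_k=c^{-1}(k)$, $k\in[K_r]$. $\tau$-coefficient. For a Polish space $\mathsf X$ with pseudometric $d_{\mathsf X}$, an $\mathsf X$-valued $X$ with $\mathbb E[d_{\mathsf X}(X,x_0)]<\infty$ for some $x_0$, and a sub-$\sigma$-field $\mathcal M$, $\tau_{d_{\mathsf X}}(\mathcal M,X):=\big\|\sup_g|\mathbb E[g(X)\mid\mathcal M]-\mathbb E[g(X)]|\big\|_{L^1(\mathbb P)}$, supremum over measurable $g:\mathsf X\to\mathbb R$ that are $1$-Lipschitz for $d_{\mathsf X}$. For $\mathcal B\subseteq\operatorname{span}\mathcal F$ and $z,z'\in\mathsf Z^m$ let $d_{\mathcal B,m}(z,z')=\sum_{s=1}^m\sup_{f\in\mathcal B}|f(z_s)-f(z_s')|$, and $$\bar\tau_{\mathcal B}(\mathcal P_M,\mathcal C_r[\mathcal P_M]):=\frac1n\sum_{k=1}^{K_r}\sum_{m\in C_k}\tau_{d_{\mathcal B,|B_m|}}\Big(\sigma\big(Z_j:j\in\textstyle\bigcup_{m'\in C_k,m'<m}B_{m'}\big),Z_{B_m}\Big),$$ with the trivial $\sigma$-field when the union is empty. Within-block dependence factor. For real random variables, $\alpha(X,Y)=2\sup_{s,t\in\mathbb R}|\mathbb P(X\ge t,Y\ge s)-\mathbb P(X\ge t)\mathbb P(Y\ge s)|$. For $B\subseteq N_n$, $\alpha_{\mathcal F,B}(\rho)=\sup_{f\in\mathcal F-\mathcal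 F}\ \sup_{i,j\in B:\,d_n(i,j)\ge\rho}\alpha(f(Z_i),f(Z_j))$, with $\alpha_{\mathcal F,B}(0):=1$ and $\alpha_{\mathcal F,B}(\infty):=0$. Let $S_B(\rho)=\{(i,j)\in B\times B:d_n(i,j)=\rho\}$ and $R(B)=\{\rho\in\{0,\dots,n-1\}\cup\{\infty\}:S_B(\rho)\neq\varnothing\}$. For $p\in(1,\infty]$, $$\Gamma_p^{\mathrm{sum}}(B)=\sqrt{\sum_{\rho\in R(B)}\tfrac{|S_B(\rho)|}{|B|}\,\alpha_{\mathcal F,B}(\rho)^{1-1/p}},\qquad \Gamma_p^\sharp(B)=\sqrt{\Big(\int_0^1\Big[\sum_{\rho\in R(B)}\tfrac{|S_B(\rho)|}{|B|}1\{\alpha_{\mathcal F,B}(\rho)\ge u\}\Big]^{\frac p{p-1}}du\Big)^{1-\frac1p}}$$ (with $p/(p-1)=1$, $1/p=0$ if $p=\infty$), and $\Gamma_1^{\mathrm{sum}}(B)=\Gamma_1^\sharp(B)=\sqrt{\sum_{\rho\in R(B)}|S_B(\rho)|/|B|}$. Finally $\Gamma_p(B)=\min\{\Gamma_p^{\mathrm{sum}}(B),\Gamma_p^\sharp(B)|B|^{1/(2p)}\}$. *)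

(* Defs.v *)
From HB Require Import structures.
From mathcomp Require Import all_boot all_order all_algebra.
From mathcomp Require Import all_classical all_reals all_analysis.
From mathcomp Require Import measurable_realfun.

Set Implicit Arguments.
Unset Strict Implicit.
Unset Printing Implicit Defensive.

Import Order.TTheory GRing.Theory Num.Theory.
Import numFieldNormedType.Exports.

Local Open Scope classical_set_scope.
Local Open Scope ring_scope.

Notation borel Z := (g_sigma_algebraType (@open Z)).

Section graph.
Context (R : realType) (V : finType) (e : rel V).

(* Values in \bar R, so that unreachable pairs are at distance +oo = inf set0. *)
Definition gdist (i j : V) : \bar R :=
  ereal_inf [set ((size s)%:R)%:E | s in [set s | path e i s /\ last i s = j]].

Definition gdist_set (A B : {set V}) : \bar R :=
  ereal_inf [set x | exists i j, [/\ i \in A, j \in B & x = gdist i j]].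

Context (M : nat) (B : 'I_M -> {set V}).

Definition block_partition : Prop :=
  injective B /\ finset.partition (B @: 'I_M)%SET [set: V]%SET.

Definition proper_coloring (r : nat) (C : Type) (c : 'I_M -> C) : Prop :=
  forall m m', c m = c m' -> m != m' -> (r%:R%:E < gdist_set (B m) (B m'))%E.

Definition num_colors (c : 'I_M -> nat) : nat :=
  size (undup [seq c m | m <- enum 'I_M]).

Definition colorable (r k : nat) : Prop :=
  exists2 c : 'I_M -> nat, proper_coloring r c & num_colors c = k.

Lemma colorable_exists (r : nat) : exists k, `[< colorable r k >].
Proof.
exists (num_colors (@nat_of_ord M)); apply/asboolP.
exists (@nat_of_ord M) => // m m' /val_inj -> /eqP; by [].
Qed.

Definition Kcol (r : nat) : nat := ex_minn (colorable_exists r).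

End graph.

Section outer_expectation.
Context d (T : measurableType d) (R : realType) (P : probability T R).

(* \int of a non-measurable nonnegative function is a lower integral; suprema
   over uncountable classes need the upper one.  For measurable h >= 0 it
   equals \int[P]_w h w. *)
Definition outer_expectation (h : T -> \bar R) : \bar R :=
  ereal_inf [set (\int[P]_w g w)%E | g in
    [set g | measurable_fun [set: T] g /\ forall w, (h w <= g w)%E]].

End outer_expectation.

Section dependence.
Context d (T : measurableType d) (R : realType) (P : probability T R).

Definition indep_systems (G H : set (set T)) : Prop :=
  forall A B, G A -> H B -> P (A `&` B) = (P A * P B)%E.

Definition sigma_field dZ (Z : measurableType dZ) (I : finType)
    (X : I -> T -> Z) (A : {set I}) : set (set T) :=
  <<s [set E | exists2 i, i \in A &
         preimage_set_system [set: T] (X i) measurable E] >>.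

Definition is_cond_exp (G : set (set T)) (Y W : T -> R) : Prop :=
  [/\ preimage_set_system [set: T] W measurable `<=` G,
      P.-integrable [set: T] (EFin \o W) &
      forall A, G A ->
        (\int[P]_(w in A) (W w)%:E = \int[P]_(w in A) (Y w)%:E)%E].

(* Conditional expectations are defined up to null sets, so the supremum of an
   uncountable family of them is the least upper bound for the a.e. order. *)
Definition is_ess_supremum (H : set (T -> R)) (Y : T -> \bar R) : Prop :=
  [/\ measurable_fun [set: T] Y,
      forall h, H h -> {ae P, forall w, ((h w)%:E <= Y w)%E} &
      forall Y', measurable_fun [set: T] Y' ->
        (forall h, H h -> {ae P, forall w, ((h w)%:E <= Y' w)%E}) ->
        {ae P, forall w, (Y w <= Y' w)%E}].

Definition lipschitz1 (S : Type) (dS : S -> S -> \bar R) (g : S -> R) : Prop :=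
  forall x y, (`|g x - g y|%:E <= dS x y)%E.

Definition tau_family dS (S : measurableType dS) (dist : S -> S -> \bar R)
    (G : set (set T)) (X : T -> S) : set (T -> R) :=
  [set h | exists g W,
     [/\ measurable_fun [set: S] g, lipschitz1 dist g,
         is_cond_exp G (g \o X) W &
         h = fun w => `|W w - fine 'E_P[g \o X]|]].

(* The essential supremum is a.e. unique: the infimum ranges over one value. *)
Definition tau dS (S : measurableType dS) (dist : S -> S -> \bar R)
    (G : set (set T)) (X : T -> S) : \bar R :=
  ereal_inf [set (\int[P]_w `|Y w|)%E | Y in
    [set Y | is_ess_supremum (tau_family dist G X) Y]].

Definition alpha (X Y : T -> R) : R :=
  2 * sup [set a | exists s t : R,
    a = `|fine (P [set w | t <= X w /\ s <= Y w])
          - fine (P [set w | t <= X w]) * fine (P [set w | s <= Y w])|].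

End dependence.

Section function_classes.
Context (R : realType) (Z : Type).

Definition supnorm (f : Z -> R) : \bar R :=
  ereal_sup [set `|f z|%:E | z in [set: Z]].

Definition diff_class (F : set (Z -> R)) : set (Z -> R) :=
  [set h | exists f g, [/\ F f, F g & h = f \- g]].

Definition cone (B : set (Z -> R)) : set (Z -> R) :=
  [set h | exists f (lam : R),
     [/\ B f, 0 < lam, h = lam \*o f & (supnorm h <= 1)%E]].

Definition diam (C : set (Z -> R)) (z : Z) : \bar R :=
  ereal_sup [set x | exists f1 f2, [/\ C f1, C f2 & x = `|f1 z - f2 z|%:E]].

Definition dist_class (B : set (Z -> R)) (m : nat) (z z' : m.-tuple Z) : \bar R :=
  (\sum_(s < m) ereal_sup [set `|f (tnth z s) - f (tnth z' s)|%:E | f in B])%E.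

End function_classes.

Section blocks.
Context d (T : measurableType d) (R : realType) (P : probability T R).
Context dZ (Z : measurableType dZ) (V : finType) (e : rel V) (X : V -> T -> Z).

Definition block_vector (B : {set V}) (w : T) : #|B|.-tuple Z :=
  [tuple X (enum_val s) w | s < #|B|].

Definition taubar (Bc : set (Z -> R)) (M K : nat) (B : 'I_M -> {set V})
    (c : 'I_M -> 'I_K) : \bar R :=
  ((#|V|%:R^-1)%:E * \sum_(k < K) \sum_(m < M | c m == k)
     tau P (@dist_class R Z Bc #|B m|)
       (sigma_field X (\bigcup_(m' < M | (c m' == k) && (m' < m)%N) B m')%SET)
       (block_vector (B m)))%E.

Context (F : set (Z -> R)).

Definition alpha_block (B : {set V}) (rho : \bar R) : R :=
  if rho == 0%E then 1 else if rho == +oo%E then 0 else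
  sup [set a | exists f i j,
    [/\ diff_class F f, i \in B, j \in B, (rho <= gdist R e i j)%E &
        a = alpha P (f \o X i) (f \o X j)]].

Definition sphere (B : {set V}) (rho : \bar R) : {set V * V} :=
  [set ij in finset.setX B B | gdist R e ij.1 ij.2 == rho]%SET.

Definition radii (B : {set V}) : seq (\bar R) :=
  [seq rho <- rcons [seq (k%:R)%:E | k <- iota 0 #|V|] +oo%E
     | (0 < #|sphere B rho|)%N].

Definition sphere_weight (B : {set V}) (rho : \bar R) : R :=
  #|sphere B rho|%:R / #|B|%:R.

Definition inv_exponent (p : \bar R) : R := if p is r%:E then r^-1 else 0.

Definition Gamma_sum (p : \bar R) (B : {set V}) : R :=
  if p == 1%E then Num.sqrt (\sum_(rho <- radii B) sphere_weight B rho) else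
  Num.sqrt (\sum_(rho <- radii B)
    sphere_weight B rho * alpha_block B rho `^ (1 - inv_exponent p)).

(* p / (p - 1) is written (1 - 1 / p)^-1, which is 1 at p = +oo. *)
Definition Gamma_sharp (p : \bar R) (B : {set V}) : R :=
  if p == 1%E then Num.sqrt (\sum_(rho <- radii B) sphere_weight B rho) else
  Num.sqrt ((\int[lebesgue_measure]_(u in `[0, 1])
    ((\sum_(rho <- radii B | (u <= alpha_block B rho)%R) sphere_weight B rho)
       `^ (1 - inv_exponent p)^-1))%R `^ (1 - inv_exponent p)).

Definition Gamma (p : \bar R) (B : {set V}) : R :=
  Num.min (Gamma_sum p B)
    (Gamma_sharp p B * (#|B|%:R : R) `^ (inv_exponent p / 2)).

End blocks.

(* Main.v *)
(**
The proof replaces the usual blocking-and-coupling argument by a softmax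
potential Phi(s) = b^-1 ln (sum_i exp (b s_i)), where i ranges over the signed
representatives +/- pi_C. Fix a colour and add the centred block sums of that
colour one at a time. Given the past, the potential of "past + new block" is a
Lipschitz function of the new block, with respect to the distance of the cone
class; so, up to tau, its conditional mean is what it would be if the block
were independent of the past, and then a second-order expansion bounds the
growth of the expected potential by 2 b times the largest variance. Hence
E Phi <= ln(2Q)/b + sum over blocks of (2 b variance + U tau). Since Phi
dominates every coordinate, summing over the K colours bounds the maximum over
the Q representatives. Variances are at most a constant times |B| Gamma_p(B)^2
by a covariance inequality for strong mixing. Choosing b of order
1 / (U q + U^2 Gamma^2 / dl) makes this bound o(n) under the hypotheses, and
the passage from representatives to F costs twice the mean of the diameter
functions.
*)

Require Import Defs.
From HB Require Import structures.
From mathcomp Require Import all_boot all_order all_algebra.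
From mathcomp Require Import all_classical all_reals all_analysis.
From mathcomp Require Import measurable_realfun.
From mathcomp Require Import ring lra.

Set Implicit Arguments.
Unset Strict Implicit.
Unset Printing Implicit Defensive.

Import Order.TTheory GRing.Theory Num.Theory.
Import numFieldNormedType.Exports.

Local Open Scope classical_set_scope.
Local Open Scope ring_scope.

(** The coefficient [tau] bounds conditional means of fixed test functions, each up to its own null
    set, whereas the potential of past plus block is a test function that varies with the past. The
    past is therefore rounded to a finite grid: finitely many test functions remain, their null sets
    can be united, and the rounding error is arbitrary. The block keeps its law under [P], so no
    independent copy and no larger probability space is needed.

    Suprema over the class and over its cells need not be measurable. They are never integrated:
    [Psi] and near-optimal majorants of the diameter functions dominate them, and Markov's
    inequality is applied to these.

    The cost [K * ln (2 * Q) / (b * n)] explains the form of the rates. As [ln (2 * Q)] is at most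
    [2 * 2 ^+ L], the part [U * q] of [b^-1] gives [K * q * 2 ^+ L / n], and the part
    [U ^+ 2 * g ^+ 2 / dl] gives [K * g ^+ 2 * 2 ^+ L / n], up to constants. The latter is a square,
    whence the square roots and the halved exponent in the condition on Gamma. *)

(* Only test functions that have a conditional expectation enter [tau_family],
   so without existence [tau] would carry no information. *)
Lemma cond_exp_exists d (T : measurableType d) (R : realType)
    (P : probability T R) (G : set (set T)) (Y : T -> R) :
    G `<=` measurable -> P.-integrable [set: T] (EFin \o Y) ->
  exists W, is_cond_exp P <<s G >> Y W.
Proof.
move=> Gm iY.
(* The identity into [T] with the coarser sigma-field transports [P] and the charge of density [Y];
   the conditional expectation is the Radon-Nikodym density there. *)
pose T' : measurableType _ := g_sigma_algebraType G.
pose i : T -> T' := idfun.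
have sGm : <<s G >> `<=` (measurable : set (set T)).
  by apply: smallest_sub => //; exact: sigma_algebra_measurable.
have mi : measurable_fun [set: T] i by move=> _ A mA; rewrite setTI; exact: sGm.
have mi' (A : set T') : measurable A -> d.-measurable (i @^-1` A).
  by move=> mA; rewrite -[X in measurable X]setTI; exact: mi.
pose im : {mfun T >-> T'} := HB.pack i (isMeasurableFun.Build _ _ _ _ i mi).
pose mu : {sigma_finite_measure set T' -> \bar R} := distribution P im.
pose nu : {charge set T' -> \bar R} := @pushforward _ _ T T' R (induced_charge iY) i.
have numu : nu mi `<< mu.
  apply/null_content_dominatesP => A mA PA.
  apply: (@null_set_integral _ T R P (i @^-1` A) (EFin \o Y)) => //; first exact: mi'.
  exact: measurable_funTS (measurable_int _ iY).
have [h [hfin hint hE]] : exists h : T' -> \bar R, [/\ (forall x, h x \is a fin_num),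
    mu.-integrable [set: T'] h &
    forall A, measurable A -> nu mi A = \int[mu]_(x in A) h x]%E.
  exists (Radon_Nikodym (nu mi) mu); split => [x||A mA].
  - exact: Radon_Nikodym_fin_num.
  - exact: Radon_Nikodym_integrable.
  - exact: Radon_Nikodym_integral.
have mh := measurable_int _ hint.
have mW : measurable_fun [set: T'] (fine \o h) by exact: measurableT_comp.
have ihi : P.-integrable [set: T] (h \o i).
  apply/integrableP; split; first exact: measurableT_comp.
  move/integrableP: hint => [_].
  rewrite [X in (X < _)%E -> _](_ : _ = (\int[P]_x `|h (i x)|)%E)//.
  rewrite [LHS](@ge0_integral_pushforward _ _ T T' R i mi P setT (abse \o h))//.
    exact: measurableT_comp.
  by move=> y _; exact: abse_ge0.
exists (fine \o h); split.
- move=> _ [A mA <-]; exact: mW.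
- have -> : EFin \o (fine \o h) = h \o i by apply/funext => x /=; rewrite fineK.
  exact: ihi.
- move=> A mA; transitivity (nu mi A); last by [].
  rewrite hE//; transitivity (\int[P]_(x in i @^-1` A) (h \o i) x)%E.
    by apply: eq_integral => x _; rewrite /= fineK.
  symmetry; apply: integral_pushforward => //.
  by apply: integrableS ihi => //; exact: mi'.
Qed.

(** * Bounded integrands and finite sums of integrals *)

Lemma integrable_bounded d (T : measurableType d) (R : realType)
    (P : probability T R) (f : T -> R) (M : R) :
  measurable_fun [set: T] f -> (forall w, `|f w| <= M) ->
  P.-integrable [set: T] (EFin \o f).
Proof.
move=> mf fM; apply: measurable_bounded_integrable => //.
  by rewrite -ge0_fin_numE//; exact: fin_num_measure.
exists M; split; first exact: num_real.
by move=> y My w _; rewrite /= (le_trans (fM w))// ltW.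
Qed.

Lemma measurable_superlevel d (T : measurableType d) (R : realType)
    (f : T -> R) (r : R) :
  measurable_fun [set: T] f -> measurable [set w | r <= f w].
Proof.
move=> mf; rewrite -[X in measurable X]setTI.
by rewrite (_ : [set w | _] = f @^-1` `[r, +oo[%classic);
  [exact: mf|apply/seteqP; split => w /=; rewrite in_itv/= andbT].
Qed.

Lemma Rintegral_cst_probability d (T : measurableType d) (R : realType)
    (P : probability T R) (r : R) : \int[P]_w r = r.
Proof.
rewrite Rintegral_cst// (_ : fine _ = 1) ?mulr1//.
exact: (congr1 fine (probability_setT P)).
Qed.

Section Rintegral_finite_sums.
Context d (T : measurableType d) (R : realType).
Context (mu : {measure set T -> \bar R}).

Lemma EFin_Rintegral (f : T -> R) : mu.-integrable [set: T] (EFin \o f) ->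
  ((\int[mu]_w f w)%:E = \int[mu]_w (f w)%:E)%E.
Proof. by move=> fi; rewrite /Rintegral fineK//; exact: integrable_fin_num. Qed.

Context (D : set T) (mD : measurable D).

Lemma integrable_sumr (I : Type) (s : seq I) (Q : pred I) (f : I -> T -> R) :
  (forall i, Q i -> mu.-integrable D (EFin \o f i)) ->
  mu.-integrable D (EFin \o (fun w => \sum_(i <- s | Q i) f i w)).
Proof.
move=> fi; rewrite (_ : _ \o _ = fun w => (\sum_(i <- s | Q i) (f i w)%:E)%E).
  exact: integrable_sum.
by apply/funext => w /=; rewrite sumEFin.
Qed.

Lemma Rintegral_sum (I : Type) (s : seq I) (Q : pred I) (f : I -> T -> R) :
  (forall i, Q i -> mu.-integrable D (EFin \o f i)) ->
  \int[mu]_(w in D) (\sum_(i <- s | Q i) f i w) =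
  \sum_(i <- s | Q i) \int[mu]_(w in D) f i w.
Proof.
move=> fi; elim: s => [|i s ih].
  under eq_Rintegral do rewrite big_nil.
  by rewrite big_nil Rintegral_cst// mul0r.
under eq_Rintegral do rewrite big_cons.
rewrite big_cons; case: ifPn => // Qi.
by rewrite RintegralD// ?ih//; [exact: fi|exact: integrable_sumr].
Qed.

End Rintegral_finite_sums.

(** * Functions selected by a finite-valued random index *)

Section dispatch.
Context d (T : measurableType d) (R : realType).
Context (mu : {measure set T -> \bar R}).
Context (J : finType) (idx : T -> J).
Hypothesis midx : forall j, measurable [set w | idx w = j].

Lemma dispatchE (f : J -> T -> R) :
  (fun w => f (idx w) w) = fun w => \sum_j (f j \_ [set w | idx w = j]) w.
Proof.
apply/funext => w; rewrite (bigD1 (idx w))//= patchE mem_set//.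
by rewrite big1 ?addr0// => j /eqP jw; rewrite patchE memNset//= => /esym.
Qed.

Lemma integrable_dispatch (f : J -> T -> R) :
  (forall j, mu.-integrable [set: T] (EFin \o f j)) ->
  mu.-integrable [set: T] (EFin \o (fun w => f (idx w) w)).
Proof.
move=> fi; rewrite dispatchE; apply: (integrable_sumr measurableT) => j _.
by rewrite -restrict_EFin; apply/(integrable_restrict _ _ measurableT) => //;
  rewrite setTI; exact: integrableS (fi j).
Qed.

Lemma Rintegral_dispatch (f : J -> T -> R) :
  (forall j, mu.-integrable [set: T] (EFin \o f j)) ->
  \int[mu]_w f (idx w) w = \sum_j \int[mu]_(w in [set w | idx w = j]) f j w.
Proof.
move=> fi.
have -> : \int[mu]_w f (idx w) w =
    \int[mu]_w (\sum_j (f j \_ [set w | idx w = j]) w).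
  by rewrite -dispatchE.
rewrite (Rintegral_sum measurableT) => [|j _].
  by apply: eq_bigr => j _; rewrite [RHS]Rintegral_mkcond.
rewrite -restrict_EFin; apply/(integrable_restrict _ _ measurableT) => //;
  by rewrite setTI; exact: integrableS (fi j).
Qed.

End dispatch.

(* Conditionally on the past, a random 1-Lipschitz function chosen by the past
   has almost its unconditional mean, the error being tau in L^1. *)
Lemma tau_decoupling d (T : measurableType d) (R : realType)
    (P : probability T R) dS (S : measurableType dS) (dist : S -> S -> \bar R)
    (G : set (set T)) (X : T -> S) (J : finType) (idx : T -> J)
    (g : J -> S -> R) (K t : R) :
  G `<=` measurable -> measurable_fun [set: T] X ->
  (forall j, <<s G >> [set w | idx w = j]) ->
  (forall j, measurable_fun [set: S] (g j)) ->
  (forall j x, `|g j x| <= K) -> (forall j, lipschitz1 dist (g j)) ->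
  (tau P dist <<s G >> X <= t%:E)%E ->
  \int[P]_w g (idx w) (X w) <=
    \int[P]_w (\int[P]_w' g (idx w) (X w')) + t.
Proof.
move=> Gm mX midx mg gK glip taut.
have sGm : <<s G >> `<=` (measurable : set (set T)).
  by apply: smallest_sub => //; exact: sigma_algebra_measurable.
have midx' j : measurable [set w | idx w = j] by exact/sGm.
have ig j : P.-integrable [set: T] (EFin \o (g j \o X)).
  by apply: (@integrable_bounded _ _ _ _ _ K) => [|w]; [exact: measurableT_comp|exact: gK].
have [W hW] := choice (fun j => cond_exp_exists Gm (ig j)).
have iW j : P.-integrable [set: T] (EFin \o W j) by have [] := hW j.
pose e j := \int[P]_w' g j (X w').
have ie j : P.-integrable [set: T] (EFin \o cst (e j)).
  exact: finite_measure_integrable_cst.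
have iWe j : P.-integrable [set: T] (EFin \o (fun w => W j w - e j)).
  by apply: eq_integrable (integrableB _ (iW j) (ie j)) => // w _.
(* Each event [idx w = j] belongs to the past, so on it [g j (X w)] and its conditional expectation
   [W j] have the same integral. *)
have -> : \int[P]_w g (idx w) (X w) = \int[P]_w W (idx w) w.
  rewrite (@Rintegral_dispatch _ _ _ P _ idx midx' (fun j w => g j (X w)))//.
  rewrite (@Rintegral_dispatch _ _ _ P _ idx midx' W)//.
  apply: eq_bigr => j _; congr fine; have [_ _ ->] := hW j => //.
rewrite -lerBlDl -RintegralB//; last 2 first.
- exact: integrable_dispatch.
- exact: (@integrable_dispatch _ _ _ P _ idx midx' (fun j w => e j)).
(* The slack [dl] is spent on picking one essential supremum [Y] near the infimum that defines
   [tau]; since [tau] is below [+oo], there is one. *)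
apply/ler_addgt0Pr => dl dl0.
have : (tau P dist <<s G >> X < (t + dl)%:E)%E.
  by rewrite (le_lt_trans taut)// lte_fin ltrDl.
move=> /ereal_inf_lt[_ [Y [mY Yub _] <-] Ylt].
rewrite -lee_fin; apply: le_trans (ltW Ylt).
have iD : P.-integrable [set: T] (EFin \o (fun w => W (idx w) w - e (idx w))).
  exact: (@integrable_dispatch _ _ _ P _ idx midx' (fun j w => W j w - e j)).
apply: (@le_trans _ _ (\int[P]_w `|(W (idx w) w - e (idx w))%:E|)%E).
  rewrite EFin_Rintegral//.
  apply: le_integral => //; first exact: integrable_abse iD.
  by move=> w _; exact: lee_abs.
apply: ae_ge0_le_integral => //.
- by apply: measurableT_comp => //; exact: measurable_int iD.
- exact: measurableT_comp.
(* Finiteness of [J] unites the null sets of the individual [j], so the bound survives the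
   substitution of the random index. *)
have : {ae P, forall w, forall j, ((`|W j w - e j|)%:E <= Y w)%E}.
  apply: filter_forall => j; apply: Yub; exists (g j), (W j); split => //.
  by rewrite unlock.
apply: filterS => w /(_ (idx w)) h _.
by rewrite /= (le_trans h)// lee_abs.
Qed.

(** After multiplication by [1 - x] the left side is at most 1, because [expR (- x)] is at least
    [1 - x], and the right side is [1 + x ^+ 2 * (1 - 2 * x)]. This is the source of every later
    condition with [2^-1]. *)
Lemma expR_le_quadratic (R : realType) (x : R) :
  x <= 2^-1 -> expR x <= 1 + x + 2 * x ^+ 2.
Proof.
move=> x2; have x1 : 0 < 1 - x by lra.
rewrite -(ler_pM2l x1).
have h : (1 - x) * expR x <= 1.
  rewrite -ler_pdivlMr ?expR_gt0// mul1r -expRN.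
  by have := expR_ge1Dx (- x).
apply: (le_trans h).
have : 0 <= x ^+ 2 * (1 - 2 * x) by rewrite mulr_ge0 ?sqr_ge0//; lra.
by rewrite !expr2; lra.
Qed.

(** * The softmax potential *)

Section softmax.
Context (R : realType) (I : finType).
Implicit Types (s y : I -> R).

Definition softmax (b : R) s : R := b^-1 * ln (\sum_i expR (b * s i)).

Context (i0 : I) (b : R) (b0 : 0 < b).

Let sum_gt0 s : 0 < \sum_i expR (b * s i).
Proof.
rewrite (bigD1 i0)//= ltr_pwDl ?expR_gt0//.
by apply: sumr_ge0 => i _; exact: expR_ge0.
Qed.

Lemma le_softmax s i : s i <= softmax b s.
Proof.
rewrite /softmax -[leLHS](mulKf (lt0r_neq0 b0)) ler_wpM2l ?invr_ge0 ?(ltW b0)//.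
rewrite -[leLHS]expRK ler_ln ?posrE ?expR_gt0 ?sum_gt0//.
by rewrite (bigD1 i)//= lerDl sumr_ge0// => j _; exact: expR_ge0.
Qed.

Lemma softmax_const0 : softmax b (fun=> 0) = b^-1 * ln #|I|%:R.
Proof. by rewrite /softmax mulr0 expR0 sumr_const. Qed.

(** Adding [dl] to all coordinates multiplies every exponential by [expR (b * dl)], which the
    logarithm gives back as [dl]; monotonicity does the rest. Used both ways, it makes the potential
    1-Lipschitz for the sup norm. *)
Lemma softmax_le s s' (dl : R) : (forall i, s i <= s' i + dl) ->
  softmax b s <= softmax b s' + dl.
Proof.
move=> ss'; rewrite /softmax -[X in _ + X](mulKf (lt0r_neq0 b0)) -mulrDr.
rewrite ler_wpM2l ?invr_ge0 ?(ltW b0)//.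
rewrite -[X in _ + X]expRK -lnM ?posrE ?expR_gt0 ?sum_gt0//.
rewrite ler_ln ?posrE ?mulr_gt0 ?expR_gt0 ?sum_gt0// mulr_suml.
apply: ler_sum => i _; rewrite -expRD ler_expR -mulrDr.
by rewrite ler_pM2l.
Qed.

Lemma softmax_lip s s' (dl : R) : (forall i, `|s i - s' i| <= dl) ->
  `|softmax b s - softmax b s'| <= dl.
Proof.
move=> ss'; rewrite ler_norml; apply/andP; split.
  rewrite lerBrDr addrC lerBlDr; apply: softmax_le => i.
  by have := ss' i; rewrite ler_norml => /andP[]; lra.
rewrite lerBlDl; apply: softmax_le => i.
by have := ss' i; rewrite ler_norml => /andP[]; lra.
Qed.

Lemma norm_softmax_le s s' (dl : R) : (forall i, `|s i - s' i| <= dl) ->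
  `|softmax b s| <= `|softmax b s'| + dl.
Proof.
move=> ss'; rewrite -[X in `|X|](subrKC (softmax b s')).
by rewrite (le_trans (ler_normD _ _))// lerD2l softmax_lip.
Qed.

(** The Gibbs weights, that is, the gradient of [softmax b] at [s]. *)
Definition softweight s i : R := expR (b * s i) / \sum_j expR (b * s j).

Lemma softweight_ge0 s i : 0 <= softweight s i.
Proof. by rewrite divr_ge0 ?expR_ge0// ltW. Qed.

Lemma sum_softweight s : \sum_i softweight s i = 1.
Proof. by rewrite -mulr_suml divff// lt0r_neq0. Qed.

(** The increment is [b^-1 * ln r], with [r] the Gibbs average of [expR (b * y i)]. Then
    [ln r <= r - 1] and the quadratic bound leave an expression that can be integrated term by
    term. *)
Lemma softmax_growth s y : (forall i, b * y i <= 2^-1) ->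
  softmax b (fun i => s i + y i) <=
  softmax b s + \sum_i softweight s i * (y i + 2 * b * y i ^+ 2).
Proof.
move=> y2.
pose S := \sum_j expR (b * s j).
pose r := \sum_i softweight s i * expR (b * y i).
have rS : \sum_i expR (b * (s i + y i)) = S * r.
  rewrite mulr_sumr; apply: eq_bigr => i _.
  rewrite mulrDr expRD /softweight mulrA; congr (_ * _).
  by rewrite -/S mulrCA divff ?mulr1 // lt0r_neq0 // sum_gt0.
have r0 : 0 < r.
  by rewrite -(pmulr_rgt0 _ (sum_gt0 s)) -/S -rS.
rewrite /softmax rS lnM ?posrE ?sum_gt0// mulrDr lerD2l.
rewrite ler_pdivrMl//.
apply: (@le_trans _ _ (r - 1)); first last.
  rewrite lerBlDr -[X in _ + X](sum_softweight s) mulr_sumr -big_split/=.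
  apply: ler_sum => i _.
  rewrite mulrCA -[X in _ + X]mulr1 -mulrDr ler_wpM2l ?softweight_ge0//.
  by apply: (le_trans (expR_le_quadratic (y2 i)));
    rewrite le_eqVlt; apply/orP; left; apply/eqP; ring.
by rewrite -[in X in X <= _](subrKC 1 r) le_ln1Dx//; lra.
Qed.

Lemma measurable_softmax d (T : measurableType d) (s : I -> T -> R) :
  (forall i, measurable_fun [set: T] (s i)) ->
  measurable_fun [set: T] (fun w => softmax b (s ^~ w)).
Proof.
move=> ms; apply: measurable_funM => //.
apply: measurableT_comp => //; apply: measurable_sum => i.
by apply: measurableT_comp => //; exact: measurable_funM.
Qed.

(** As [s] is not random, neither are the weights: centring kills the linear terms, and weights of
    sum 1 keep the quadratic ones below [2 * b * v], whatever the size of [I]. *)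
Lemma Rintegral_softmax_le d (T : measurableType d) (P : probability T R)
    s (Y : I -> T -> R) (v : R) :
  (forall i, measurable_fun [set: T] (Y i)) ->
  (forall i w, b * `|Y i w| <= 2^-1) ->
  (forall i, \int[P]_w Y i w = 0) ->
  (forall i, \int[P]_w (Y i w) ^+ 2 <= v) ->
  \int[P]_w softmax b (fun i => s i + Y i w) <= softmax b s + 2 * b * v.
Proof.
move=> mY Yb Y0 Yv.
have Yb' i w : `|Y i w| <= b^-1 * 2^-1 by rewrite -ler_pdivrMl ?invr_gt0// invrK.
have iY i : P.-integrable [set: T] (EFin \o Y i).
  exact: integrable_bounded (Yb' i).
have iY2 i : P.-integrable [set: T] (EFin \o (fun w => (Y i w) ^+ 2)).
  apply: (@integrable_bounded _ _ _ _ _ ((b^-1 * 2^-1) ^+ 2)) => [|w].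
    exact: measurable_funX.
  by rewrite normrX lerXn2r// nnegrE (le_trans (normr_ge0 _) (Yb' i w)).
pose q i w := softweight s i * (Y i w + 2 * b * (Y i w) ^+ 2).
have iq' i : P.-integrable [set: T] (EFin \o (fun w => 2 * b * (Y i w) ^+ 2)).
  by under eq_fun do rewrite /=; exact: (integrableZl _ _ (iY2 i)).
have iq'' i : P.-integrable [set: T] (EFin \o (fun w => Y i w + 2 * b * (Y i w) ^+ 2)).
  exact: (integrableD _ (iY i) (iq' i)).
have iq i : P.-integrable [set: T] (EFin \o q i).
  exact: (integrableZl _ _ (iq'' i)).
have iqs : P.-integrable [set: T] (EFin \o (fun w => \sum_i q i w)).
  by apply: (integrable_sumr measurableT) => i _.
have ic : P.-integrable [set: T] (EFin \o cst (softmax b s)).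
  exact: finite_measure_integrable_cst.
have iS : P.-integrable [set: T]
    (EFin \o (fun w => softmax b (fun i => s i + Y i w))).
  apply: (@integrable_bounded _ _ _ _ _ (`|softmax b s| + b^-1 * 2^-1)) => [|w].
    by apply: measurable_softmax => i; exact: measurable_funD.
  by apply: norm_softmax_le => i; rewrite addrC addKr.
apply: (@le_trans _ _ (\int[P]_w (softmax b s + \sum_i q i w))).
  apply: le_Rintegral => //; first exact: (integrableD _ ic iqs).
  move=> w _; apply: softmax_growth => i.
  by apply: le_trans (Yb i w); rewrite ler_wpM2l ?(ltW b0)// ler_norm.
rewrite RintegralD// Rintegral_cst_probability lerD2l.
rewrite (Rintegral_sum measurableT)// -[leRHS]mul1r -[X in _ <= X * _](sum_softweight s) mulr_suml.
apply: ler_sum => i _; rewrite RintegralZl// ler_wpM2l ?softweight_ge0//.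
by rewrite RintegralD// Y0 add0r RintegralZl// ler_wpM2l// mulr_ge0// ltW.
Qed.

End softmax.

(** * Decoupling a colour class *)

(** Each coordinate is rounded down to a grid of mesh [dl]; boundedness leaves finitely many
    cells. *)
Lemma measurable_discretization d (T : measurableType d) (R : realType)
    (I : finType) (h : I -> T -> R) (K dl : R) : 0 < dl ->
  (forall i, measurable_fun [set: T] (h i)) -> (forall i w, `|h i w| <= K) ->
  exists (J : finType) (idx : T -> J) (c : J -> I -> R),
    (forall j, measurable [set w | idx w = j]) /\
    (forall w i, `|h i w - c (idx w) i| <= dl).
Proof.
move=> dl0 mh hK.
pose u i w := (h i w + K) / dl.
have u0 i w : 0 <= u i w.
  by rewrite divr_ge0 ?(ltW dl0)//; have := hK i w; rewrite ler_norml => /andP[]; lra.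
pose n := Num.truncn ((K + K) / dl).
pose idx w : {ffun I -> 'I_n.+1} := [ffun i => inord (Num.truncn (u i w))].
(* Needed for [inord] to be faithful: out of range it would return its default value 0. *)
have uK i w : (Num.truncn (u i w) < n.+1)%N.
  rewrite ltnS; apply: le_truncn; rewrite ler_wpM2r ?invr_ge0 ?(ltW dl0)//.
  by rewrite lerD2r (le_trans (ler_norm _)).
exists {ffun I -> 'I_n.+1}, idx, (fun (j : {ffun I -> 'I_n.+1}) i => (j i)%:R * dl - K); split.
  move=> j.
  have -> : [set w | idx w = j] =
      \bigcap_(i in [set: I]) (u i @^-1` `[(j i)%:R, (j i).+1%:R[%classic).
    apply/seteqP; split => w /=.
      move=> <- i _; rewrite /= in_itv/= ffunE inordK//.
      exact: truncn_itv.
    move=> wj; apply/ffunP => i; rewrite ffunE.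
    have /= := wj i Logic.I; rewrite in_itv/= => h1.
    by apply/val_inj; rewrite /= inordK//; exact: truncn_def.
  apply: fin_bigcap_measurable => // i _.
  rewrite -[X in measurable X]setTI.
  suff : measurable_fun [set: T] (u i) by apply.
  by apply: measurable_funM => //; exact: measurable_funD.
move=> w i; rewrite ffunE inordK//.
have /andP[h1 h2] := truncn_itv (u0 i w).
have -> : h i w = u i w * dl - K by rewrite /u divfK ?lt0r_neq0// addrK.
rewrite opprB addrA subrK -mulrBl normrM (gtr0_norm dl0) ler_piMl ?(ltW dl0)//.
by move: h1 h2; rewrite -natr1 ler_norml; lra.
Qed.

(** The past is frozen at a grid point, the block is decoupled from it at cost [U * t], the mean
    over the block alone costs [2 * b * v], and the past is released again. *)
Lemma softmax_block_step d (T : measurableType d) (R : realType)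
    (P : probability T R) dS (S : measurableType dS) (dist : S -> S -> \bar R)
    (G : set (set T)) (X : T -> S) (I : finType) (i0 : I) (b U K t v : R)
    (s : I -> T -> R) (y : I -> S -> R) :
  0 < b -> 0 < U -> G `<=` measurable -> measurable_fun [set: T] X ->
  (forall i, measurable_fun [set: g_sigma_algebraType G] (s i)) ->
  (forall i w, `|s i w| <= K) ->
  (forall i, measurable_fun [set: S] (y i)) ->
  (forall i x, b * `|y i x| <= 2^-1) ->
  (forall i x x', (`|y i x - y i x'|%:E <= U%:E * dist x x')%E) ->
  (forall i, \int[P]_w y i (X w) = 0) ->
  (forall i, \int[P]_w (y i (X w)) ^+ 2 <= v) ->
  (tau P dist <<s G >> X <= t%:E)%E ->
  \int[P]_w softmax b (fun i => s i w + y i (X w)) <=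
    \int[P]_w softmax b (s ^~ w) + 2 * b * v + U * t.
Proof.
move=> b0 U0 Gm mX ms sK my yb ylip y0 yv taut.
have sGm : <<s G >> `<=` (measurable : set (set T)).
  by apply: smallest_sub => //; exact: sigma_algebra_measurable.
have msT i : measurable_fun [set: T] (s i).
  by move=> _ A mA; apply: sGm; exact: (ms i measurableT A mA).
have yb' i x : `|y i x| <= b^-1 * 2^-1 by rewrite -ler_pdivrMl ?invr_gt0// invrK.
have softb (r c : I -> R) (dl : R) : (forall i, `|r i - c i| <= dl) ->
    softmax b r <= softmax b c + dl /\ softmax b c <= softmax b r + dl.
  by move=> /(softmax_lip i0 b0); rewrite ler_norml => /andP[]; lra.
(* Half of [e] pays for freezing the past, half for releasing it. *)
apply/ler_addgt0Pr => e e0; pose dl : R := e / 2.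
have dl0 : 0 < dl by rewrite divr_gt0.
(* Discretising the past leaves finitely many test functions of the block. *)
have [J [idx [c [midx cP]]]] := measurable_discretization dl0 ms sK.
pose h j x := softmax b (fun i => c j i + y i x).
pose H := \sum_j `|softmax b (c j)| + b^-1 * 2^-1.
have hH j x : `|h j x| <= H.
  apply: (@le_trans _ _ (`|softmax b (c j)| + b^-1 * 2^-1)).
    by apply: (norm_softmax_le i0 b0) => i; rewrite addrC addKr.
  by rewrite lerD2r (bigD1 j)//= lerDl sumr_ge0.
have mh j : measurable_fun [set: S] (h j).
  by apply: measurable_softmax => // i; exact: measurable_funD.
(* Only 1-Lipschitz functions are admissible in [tau]; the potential inherits the constant [U] of
   the [y i], hence this scaling, undone later as [U * t]. *)
have hlip j : lipschitz1 dist (fun x => U^-1 * h j x).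
  move=> x x'; rewrite -mulrBr normrM gtr0_norm ?invr_gt0// EFinM.
  rewrite lee_pdivrMl//.
  suff : (`|h j x - h j x'|%:E <= U%:E * dist x x')%E by [].
  (* This rules out the value [-oo]; at [+oo] the bound is trivial. *)
  have d0 : (0 <= U%:E * dist x x')%E by apply: le_trans (ylip i0 x x').
  have := fun i => ylip i x x'; move: d0; case: (U%:E * dist x x')%E => [r| |]//.
    move=> _ yr; rewrite lee_fin; apply: softmax_lip => // i.
    have := yr i; rewrite lee_fin; congr (_ <= _); congr (`| _ |); ring.
  by move=> _ _; exact: leey.
have midxT j : d.-measurable [set w : T | idx w = j] by exact: sGm (midx j).
have ihj j : P.-integrable [set: T] (EFin \o (fun w => h j (X w))).
  by apply: (@integrable_bounded _ _ _ _ _ H) => [|w]; [exact: measurableT_comp|exact: hH].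
have ih : P.-integrable [set: T] (EFin \o (fun w => h (idx w) (X w))).
  exact: (@integrable_dispatch _ _ _ P _ idx midxT (fun j w => h j (X w))).
have icst (r : R) : P.-integrable [set: T] (EFin \o cst r).
  exact: finite_measure_integrable_cst.
have is1 : P.-integrable [set: T] (EFin \o (fun w => softmax b (s ^~ w))).
  apply: (@integrable_bounded _ _ _ _ _ (`|softmax b (fun=> 0 : R)| + K)) => [|w].
    exact: measurable_softmax.
  by apply: (norm_softmax_le i0 b0) => i; rewrite subr0.
have is2 : P.-integrable [set: T]
    (EFin \o (fun w => softmax b (fun i => s i w + y i (X w)))).
  apply: (@integrable_bounded _ _ _ _ _
      (`|softmax b (fun=> 0 : R)| + (K + b^-1 * 2^-1))) => [|w].
    apply: measurable_softmax => // i; apply: measurable_funD => //.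
    exact: measurableT_comp.
  apply: (norm_softmax_le i0 b0) => i; rewrite subr0 (le_trans (ler_normD _ _))//.
  by rewrite lerD.
have iEh : P.-integrable [set: T]
    (EFin \o (fun w => \int[P]_w' h (idx w) (X w'))).
  exact: (@integrable_dispatch _ _ _ P _ idx midxT
    (fun j w => \int[P]_w' h j (X w')) (fun j => icst _)).
have dec : \int[P]_w h (idx w) (X w) <=
    \int[P]_w (\int[P]_w' h (idx w) (X w')) + U * t.
  have dec' : \int[P]_w (U^-1 * h (idx w) (X w)) <=
      \int[P]_w (\int[P]_w' (U^-1 * h (idx w) (X w'))) + t.
    apply: (@tau_decoupling _ T R P _ S dist G X J idx
      (fun j x => U^-1 * h j x) (U^-1 * H) t Gm mX midx) => // [j|j x].
      exact: measurable_funM.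
    by rewrite normrM gtr0_norm ?invr_gt0// ler_pM2l ?invr_gt0.
  have E1 : \int[P]_w (\int[P]_w' (U^-1 * h (idx w) (X w'))) =
      \int[P]_w (U^-1 * \int[P]_w' h (idx w) (X w')).
    by apply: eq_Rintegral => w _; rewrite RintegralZl//; exact: ihj.
  rewrite E1 (RintegralZl _ measurableT ih) (RintegralZl _ measurableT iEh) in dec'.
  rewrite -(ler_pM2l U0) mulrDr !mulrA in dec'; move: dec'.
  by rewrite divff ?lt0r_neq0// !mul1r.
have stepa : \int[P]_w softmax b (fun i => s i w + y i (X w)) <=
    \int[P]_w h (idx w) (X w) + dl.
  rewrite -[X in _ + X](Rintegral_cst_probability P) -(RintegralD measurableT)//; last exact: icst.
  apply: le_Rintegral => //; first exact: (integrableD _ ih (icst dl)).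
  move=> w _; apply: (proj1 (softb _ _ _ _)) => i.
  by rewrite opprD addrACA subrr addr0.
have stepb : \int[P]_w (\int[P]_w' h (idx w) (X w')) <=
    \int[P]_w softmax b (s ^~ w) + (dl + 2 * b * v).
  rewrite -[X in _ + X](Rintegral_cst_probability P) -(RintegralD measurableT)//; last exact: icst.
  apply: le_Rintegral => //; first exact: (integrableD _ is1 (icst _)).
  move=> w _; apply: (@le_trans _ _ (softmax b (c (idx w)) + 2 * b * v)).
    by apply: Rintegral_softmax_le => // i; exact: measurableT_comp.
  by rewrite addrA lerD2r; apply: (proj2 (softb _ _ _ _)) => i.
rewrite (splitr e) -/dl; apply: (le_trans stepa).
rewrite [leRHS]addrA lerD2r; apply: (le_trans dec).
rewrite [leRHS]addrAC lerD2r; apply: (le_trans stepb).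
by rewrite addrA [leLHS]addrAC.
Qed.

Lemma measurable_sum_cond d (T : measurableType d) (R : realType) (D : set T)
    (J : Type) (s : seq J) (Q : pred J) (f : J -> T -> R) :
  (forall j, Q j -> measurable_fun D (f j)) ->
  measurable_fun D (fun w => \sum_(j <- s | Q j) f j w).
Proof.
move=> mf; rewrite (_ : (fun w => _) =
    fun w => \sum_(j <- s) (if Q j then f j w else 0)).
  apply: measurable_sum => j; case: (boolP (Q j)) => [/mf//|_].
  exact: measurable_cst.
by apply/funext => w; exact: big_mkcond.
Qed.

Section colour_class.
Context d (T : measurableType d) (R : realType) (P : probability T R).
Context dZ (Z : measurableType dZ) (V : finType) (X : V -> T -> Z).
Hypothesis mX : forall u, measurable_fun [set: T] (X u).
Context (I : finType) (i0 : I) (h : I -> Z -> R) (U : R).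
Hypothesis U0 : 0 < U.
Hypothesis mh : forall i, measurable_fun [set: Z] (h i).
Hypothesis hU : forall i z, `|h i z| <= U.
Context (Bc : set (Z -> R)).
Hypothesis hBc : forall i z z',
  (`|h i z - h i z'|%:E <= U%:E * ereal_sup [set `|f z - f z'|%:E | f in Bc])%E.
Context (M : nat) (B : 'I_M -> {set V}) (Q : pred 'I_M) (t v : 'I_M -> R) (b : R).
Hypothesis b0 : 0 < b.
Hypothesis bU : forall m, b * (2 * U * #|B m|%:R) <= 2^-1.

Definition block_sum (D : {set V}) i w :=
  \sum_(u in D) (h i (X u w) - \int[P]_w h i (X u w)).

Hypothesis tau_le : forall m, Q m ->
  (tau P (@dist_class R Z Bc #|B m|)
     (sigma_field X (\bigcup_(m' < M | Q m' && (m' < m)%N) B m')%SET)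
     (block_vector X (B m)) <= (t m)%:E)%E.
Hypothesis var_le : forall m i, \int[P]_w (block_sum (B m) i w) ^+ 2 <= v m.

Lemma norm_mean_le i u : `|\int[P]_w h i (X u w)| <= U.
Proof.
have ihX : P.-integrable [set: T] (EFin \o (fun w => h i (X u w))).
  by apply: (@integrable_bounded _ _ _ _ _ U) => //; exact: measurableT_comp.
apply: (le_trans (le_normr_Rintegral _ _)) => //.
rewrite -[leRHS](Rintegral_cst_probability P); apply: le_Rintegral => //.
- exact: integrable_norm.
- exact: finite_measure_integrable_cst.
Qed.

Lemma block_sum_le D i w : `|block_sum D i w| <= 2 * U * #|D|%:R.
Proof.
apply: (le_trans (ler_norm_sum _ _ _)).
rewrite mulr_natr -sumr_const; apply: ler_sum => u _.
by rewrite (le_trans (ler_normB _ _))// mulr_natl mulr2n lerD// norm_mean_le.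
Qed.

Lemma Rintegral_block_sum D i : \int[P]_w block_sum D i w = 0.
Proof.
have ihX u : P.-integrable [set: T] (EFin \o (fun w => h i (X u w))).
  by apply: (@integrable_bounded _ _ _ _ _ U) => //; exact: measurableT_comp.
have ic (r : R) : P.-integrable [set: T] (EFin \o cst r).
  exact: finite_measure_integrable_cst.
rewrite (Rintegral_sum measurableT) => [|u _]; last exact: (integrableB _ (ihX u) (ic _)).
rewrite big1// => u _; rewrite (RintegralB measurableT (ihX u) (ic _)).
  by rewrite Rintegral_cst_probability subrr.
Qed.

Definition partial_sum (j : nat) i w :=
  \sum_(m < M | Q m && (m < j)%N) block_sum (B m) i w.

(** Blocks are accumulated in the order of their indices, the order that defines the past in
    [taubar]; so the past of block [j] contains all the information in this sum. *)
Lemma measurable_partial_sum j i :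
  measurable_fun [set: g_sigma_algebraType
    [set E | exists2 u, u \in (\bigcup_(m' < M | Q m' && (m' < j)%N) B m')%SET &
      preimage_set_system [set: T] (X u) measurable E]] (partial_sum j i).
Proof.
set A := (\bigcup_(m' < M | _) B m')%SET.
set T' := g_sigma_algebraType _.
apply: measurable_sum_cond => m Qm; apply: measurable_sum_cond => u um.
apply: measurable_funB => //; apply: measurableT_comp => //.
move=> _ E mE; apply: sub_sigma_algebra; exists u; last by exists E.
by apply/bigcupP; exists m.
Qed.

(** Induction over all block indices: one outside the colour changes nothing, one inside it is a
    [softmax_block_step]. The logarithm is the potential of the empty sum. *)
Lemma Rintegral_softmax_partial_sum j : (j <= M)%N ->
  \int[P]_w softmax b (partial_sum j ^~ w) <=
  b^-1 * ln #|I|%:R + \sum_(m < M | Q m && (m < j)%N) (2 * b * v m + U * t m).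
Proof.
elim: j => [_|j ih jM].
  under eq_Rintegral do (rewrite (_ : partial_sum 0 ^~ _ = fun=> 0);
    last by apply/funext => i; rewrite /partial_sum big_pred0// => m; rewrite andbF).
  rewrite big_pred0; last by move=> m; rewrite andbF.
  by rewrite Rintegral_cst_probability (softmax_const0 I) addr0.
pose m := Ordinal jM.
have [Qm|nQm] := boolP (Q m); last first.
  have QE : (fun m' : 'I_M => Q m' && (m' < j.+1)%N) =1 (fun m' => Q m' && (m' < j)%N).
    move=> m'; rewrite ltnS leq_eqVlt; case: eqP => //= m'j.
    by rewrite (_ : m' = m) ?(negbTE nQm)//; exact: val_inj.
  rewrite (eq_bigl _ _ QE).
  have -> : partial_sum j.+1 = partial_sum j.
    by apply/funext => i; apply/funext => w; rewrite /partial_sum (eq_bigl _ _ QE).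
  exact/ih/ltnW.
have splitE (F : 'I_M -> R) : \sum_(m' < M | Q m' && (m' < j.+1)%N) F m' =
    \sum_(m' < M | Q m' && (m' < j)%N) F m' + F m.
  rewrite (bigD1 m)/= ?Qm ?ltnSn// addrC; congr (_ + _).
  apply: eq_bigl => m'; rewrite ltnS leq_eqVlt -andbA; congr (_ && _).
  rewrite -val_eqE/=; case: eqP => /= [->|]; first by rewrite ltnn.
  by rewrite andbT.
(* [tau] concerns functions of the vector of the block, so the block sum is rewritten as one; the
   centring constants cancel in its differences. *)
pose y i (x : #|B m|.-tuple Z) :=
  \sum_(s < #|B m|) (h i (tnth x s) - \int[P]_w h i (X (enum_val s) w)).
have yE i w : y i (block_vector X (B m) w) = block_sum (B m) i w.
  rewrite /block_sum big_enum_val /y; apply: eq_bigr => s _.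
  by rewrite tnth_mktuple.
have -> : \int[P]_w softmax b (partial_sum j.+1 ^~ w) = \int[P]_w
    softmax b (fun i => partial_sum j i w + y i (block_vector X (B m) w)).
  apply: eq_Rintegral => w _; congr softmax; apply/funext => i.
  by rewrite /partial_sum splitE yE.
rewrite splitE addrA.
apply: (@le_trans _ _ (\int[P]_w softmax b (partial_sum j ^~ w)
    + 2 * b * v m + U * t m)); last first.
  by rewrite -[leLHS]addrA lerD2r; exact/ih/ltnW.
apply: (@softmax_block_step _ T R P _ _ (@dist_class R Z Bc #|B m|)
  [set E | exists2 u, u \in (\bigcup_(m' < M | Q m' && (m' < j)%N) B m')%SET &
      preimage_set_system [set: T] (X u) measurable E] _ _ i0 b U
  (\sum_(m' < M) 2 * U * #|B m'|%:R)) => //.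
- move=> E [u _ [E' mE' <-]]; exact: mX.
- apply/measurable_fun_tnthP => s; rewrite /block_vector.
  rewrite (_ : _ \o _ = X (enum_val s))//.
  by apply/funext => w /=; rewrite tnth_mktuple.
- exact: measurable_partial_sum.
- move=> i w; apply: (le_trans (ler_norm_sum _ _ _)).
  rewrite big_mkcond/=; apply: ler_sum => m' _; case: ifPn => _.
    exact: block_sum_le.
  by rewrite !mulr_ge0// ltW.
- move=> i; apply: measurable_sum => s; apply: measurable_funB => //.
  by apply: measurableT_comp => //; exact: measurable_tnth.
- move=> i x; apply: le_trans (bU m); rewrite ler_pM2l//.
  apply: (le_trans (ler_norm_sum _ _ _)).
  rewrite mulr_natr -[X in _ *+ X]card_ord -sumr_const; apply: ler_sum => s _.
  by rewrite (le_trans (ler_normB _ _))// mulr_natl mulr2n lerD// norm_mean_le.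
- move=> i x x'.
  apply: (@le_trans _ _ (\sum_(s < #|B m|) `|h i (tnth x s) - h i (tnth x' s)|%:E)%E).
    rewrite sumEFin lee_fin /y -sumrB.
    under eq_bigr do rewrite opprB addrA subrK.
    exact: ler_norm_sum.
  rewrite /dist_class ge0_sume_distrr.
    by apply: lee_sum => s _; exact: hBc.
  (* Distributing [U] requires nonnegative terms; [hBc] itself excludes the supremum [-oo] of an
     empty class. *)
  move=> s _; have := hBc i (tnth x s) (tnth x' s).
  move/(le_trans (_ : (0 <= `|_|%:E)%E)); rewrite lee_fin normr_ge0 => /(_ isT).
  by rewrite pmule_rge0.
- move=> i; under eq_Rintegral do rewrite yE.
  exact: Rintegral_block_sum.
- by move=> i; under eq_Rintegral do rewrite yE; exact: var_le.
- exact: tau_le Qm.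
Qed.

End colour_class.

(** The sign as a second index turns absolute values into coordinates and gives the 2 in the
    logarithm. Nothing relates different colours, so [Psi] adds up their potentials and the
    logarithm is paid [K] times. As [Psi] does not depend on [i], its mean bounds that of the
    maximum. *)
Lemma maximal_inequality d (T : measurableType d) (R : realType)
    (P : probability T R) dZ (Z : measurableType dZ) (V : finType)
    (X : V -> T -> Z) (I : finType) (h : I -> Z -> R) (U : R)
    (Bc : set (Z -> R)) (M K : nat) (B : 'I_M -> {set V}) (c : 'I_M -> 'I_K)
    (t v : 'I_M -> R) (b : R) :
  (forall u, measurable_fun [set: T] (X u)) -> I -> 0 < U ->
  (forall i, measurable_fun [set: Z] (h i)) -> (forall i z, `|h i z| <= U) ->
  (forall i z z', (`|h i z - h i z'|%:E <=
     U%:E * ereal_sup [set `|f z - f z'|%:E | f in Bc])%E) ->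
  0 < b -> (forall m, b * (2 * U * #|B m|%:R) <= 2^-1) ->
  (forall k m, c m == k -> (tau P (@dist_class R Z Bc #|B m|)
     (sigma_field X (\bigcup_(m' < M | (c m' == k) && (m' < m)%N) B m')%SET)
     (block_vector X (B m)) <= (t m)%:E)%E) ->
  (forall m i, \int[P]_w (block_sum P X h (B m) i w) ^+ 2 <= v m) ->
  exists Psi : T -> R, [/\ P.-integrable [set: T] (EFin \o Psi),
    forall i w, `|\sum_(m < M) block_sum P X h (B m) i w| <= Psi w &
    \int[P]_w Psi w <= K%:R * (b^-1 * ln (2 * #|I|%:R)) +
      \sum_(m < M) (2 * b * v m + U * t m)].
Proof.
move=> mX i0 U0 mh hU hBc b0 bU tau_le var_le.
pose h' (i : I * bool) z := (-1) ^+ i.2 * h i.1 z.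
have mh' i : measurable_fun [set: Z] (h' i) by exact: measurable_funM.
have hU' i z : `|h' i z| <= U by rewrite normrMsign hU.
have hBc' i z z' : (`|h' i z - h' i z'|%:E <=
     U%:E * ereal_sup [set `|f z - f z'|%:E | f in Bc])%E.
  by rewrite -mulrBr normrMsign hBc.
have bsE D i w : block_sum P X h' D i w = (-1) ^+ i.2 * block_sum P X h D i.1 w.
  rewrite /block_sum mulr_sumr; apply: eq_bigr => u _.
  rewrite mulrBr; congr (_ - _); rewrite RintegralZl//.
  by apply: (@integrable_bounded _ _ _ _ _ U) => //; exact: measurableT_comp.
have var_le' m i : \int[P]_w (block_sum P X h' (B m) i w) ^+ 2 <= v m.
  apply: le_trans (var_le m i.1).
  by under eq_Rintegral do rewrite bsE exprMn sqrr_sign mul1r.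
pose S k i w := partial_sum P X h' B (fun m => c m == k) M i w.
have SE k i w : S k i w = \sum_(m < M | c m == k) block_sum P X h' (B m) i w.
  by apply: eq_bigl => m; rewrite ltn_ord andbT.
have mS k i : measurable_fun [set: T] (S k i).
  apply: measurable_sum_cond => m _; apply: measurable_sum_cond => u _.
  by apply: measurable_funB => //; exact: measurableT_comp.
have iS k : P.-integrable [set: T] (EFin \o (fun w => softmax b (S k ^~ w))).
  apply: (@integrable_bounded _ _ _ _ _ (`|softmax b (fun=> 0 : R)| +
      \sum_(m < M) 2 * U * #|B m|%:R)) => [|w].
    by apply: measurable_softmax => //; exact: (i0, true).
  apply: (norm_softmax_le (i0, true) b0) => i; rewrite subr0 SE.
  apply: (le_trans (ler_norm_sum _ _ _)).
  rewrite big_mkcond/=; apply: ler_sum => m _; case: ifPn => _.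
    exact: block_sum_le.
  by rewrite !mulr_ge0// ltW.
exists (fun w => \sum_(k < K) softmax b (S k ^~ w)); split.
- exact: (integrable_sumr measurableT).
- move=> i w.
  have key (s : bool) : (-1) ^+ s * \sum_(m < M) block_sum P X h (B m) i w <=
      \sum_(k < K) softmax b (S k ^~ w).
    rewrite (partition_big c predT)//= mulr_sumr; apply: ler_sum => k _.
    apply: le_trans (le_softmax (i, s) b0 _ (i, s)).
    by rewrite SE mulr_sumr; under eq_bigr do rewrite -(bsE _ (i, s)).
  rewrite ler_norml; have := key true; have := key false.
  by rewrite expr0 expr1 mul1r mulN1r lerNl => -> ->.
- rewrite (Rintegral_sum measurableT)//.
  rewrite [X in _ <= _ + X](partition_big c predT)//= mulr_natl.
  rewrite -[X in _ *+ X]card_ord -sumr_const -big_split/=.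
  apply: ler_sum => k _.
  have -> : 2 * #|I|%:R = #|{: I * bool}|%:R :> R.
    by rewrite card_prod card_bool natrM mulrC.
  under [X in _ <= _ + X]eq_bigl => m do rewrite -[_ == _]andbT -(ltn_ord m).
  apply: Rintegral_softmax_partial_sum => //; first exact: (i0, true).
  by move=> m cmk; exact: tau_le.
Qed.

(** * Covariances and the dependence factor *)

(** The sum is the integer part of [y], as it counts the integers from 1 to [N] that are at most
    [y]. *)
Lemma staircase_sum (R : realType) (y : R) N : 0 <= y <= N%:R ->
  \sum_(j < N) (j.+1%:R <= y)%R%:R <= y <= \sum_(j < N) (j.+1%:R <= y)%R%:R + 1.
Proof.
have full n : n%:R <= y -> \sum_(j < n) (j.+1%:R <= y)%R%:R = n%:R :> R.
  move=> ny; rewrite (eq_bigr (fun=> 1)) ?sumr_const ?card_ord// => j _.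
  by rewrite (le_trans _ ny)// ler_nat.
elim: N => [|N ih] /andP[y0 yN]; first by rewrite big_ord0 y0/= add0r (le_trans yN).
have [yN1|yN1] := eqVneq y N.+1%:R; first by rewrite full ?yN1// lexx/= lerDl.
rewrite big_ord_recr/= [(N.+1%:R <= y)%R]lt_geF ?addr0; last by rewrite lt_neqAle yN1.
have [yN'|/ltW yN'] := leP y N%:R; first by rewrite ih// y0.
by rewrite full// yN'/= natr1.
Qed.

Lemma product_approx (R : realType) (W c x x' y y' : R) :
  x' <= x <= x' + c -> y' <= y <= y' + c -> 0 <= x' -> 0 <= y' ->
  x <= W -> y <= W -> 0 <= x * y - x' * y' <= 2 * W * c.
Proof.
move=> /andP[x1 x2] /andP[y1 y2] x'0 y'0 xW yW.
have -> : x * y - x' * y' = x * (y - y') + y' * (x - x') by ring.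
have -> : 2 * W * c = W * c + W * c by ring.
apply/andP; split; first by rewrite addr_ge0 ?mulr_ge0 ?subr_ge0// (le_trans x'0).
apply: lerD; apply: ler_pM; rewrite ?subr_ge0// ?(le_trans x'0)//;
  rewrite ?lerBlDl//; exact: le_trans yW.
Qed.

Section covariance.
Context d (T : measurableType d) (R : realType) (P : probability T R).

Let int_bnd (f : T -> R) (K : R) : measurable_fun [set: T] f ->
  (forall w, 0 <= f w <= K) -> P.-integrable [set: T] (EFin \o f) /\
  0 <= \int[P]_w f w <= K.
Proof.
move=> mf fK.
have fi : P.-integrable [set: T] (EFin \o f).
  apply: (@integrable_bounded _ _ _ _ _ K) => // w.
  by have /andP[f0 fK'] := fK w; rewrite ger0_norm.
split => //; rewrite Rintegral_ge0 => [|w _]; last by have /andP[] := fK w.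
rewrite -[leRHS](Rintegral_cst_probability P) le_Rintegral//.
- exact: finite_measure_integrable_cst.
- by move=> w _; have /andP[] := fK w.
Qed.

(* Discretised form of Hoeffding's covariance identity: X and Y are replaced by
   averages of the indicators of their superlevel sets. *)
Lemma covariance_ge0_le (X Y : T -> R) (W a : R) : 0 < W ->
  measurable_fun [set: T] X -> measurable_fun [set: T] Y ->
  (forall w, 0 <= X w <= W) -> (forall w, 0 <= Y w <= W) ->
  (forall s t, `|fine (P [set w | t <= X w /\ s <= Y w])
     - fine (P [set w | t <= X w]) * fine (P [set w | s <= Y w])| <= a) ->
  `|\int[P]_w (X w * Y w) - (\int[P]_w X w) * (\int[P]_w Y w)| <= W ^+ 2 * a.
Proof.
move=> W0 mX mY X0 Y0 Pa; apply/ler_addgt0Pr => e e0.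
(* With mesh [c = W / N], discretising moves the mean of the product and the product of the means by
   amounts that both lie in [[0, 2 * W * c]]; their difference is then at most [2 * W * c] in
   absolute value. *)
have [N N0 Ne] : exists2 N : nat, (0 < N)%N & 2 * W * (W / N%:R) <= e.
  exists (Num.truncn (e^-1 * (2 * W * W))).+1 => //.
  rewrite mulrA ler_pdivrMr ?ltr0n// -ler_pdivrMl//.
  by rewrite ltW// truncnS_gt.
pose c := W / N%:R.
have c0 : 0 < c by rewrite divr_gt0// ltr0n.
have cN : c * N%:R = W by rewrite divfK// pnatr_eq0 -lt0n.
have {}Ne : 2 * W * c <= e by [].
clearbody c.
pose A (f : T -> R) j := [set w | c * j.+1%:R <= f w].
pose st (f : T -> R) w : R := \sum_(j < N) \1_(A f j) w.
have stP (f : T -> R) w : 0 <= f w <= W -> c * st f w <= f w <= c * st f w + c.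
  move=> /andP[f0 fW].
  have fN : 0 <= f w / c <= N%:R by rewrite (divr_ge0 f0 (ltW c0))/= ler_pdivrMr// mulrC cN.
  have := staircase_sum fN.
  have <- : st f w = \sum_(j < N) (j.+1%:R <= f w / c)%R%:R.
    apply: eq_bigr => j _; rewrite indicE /A mem_setE/=.
    by rewrite ler_pdivlMr// mulrC.
  rewrite ler_pdivlMr// ler_pdivrMr// mulrDl mul1r.
  by rewrite [_ * c]mulrC.
have mA (f : T -> R) j : measurable_fun [set: T] f -> measurable (A f j).
  exact: measurable_superlevel.
have mst (f : T -> R) : measurable_fun [set: T] f -> measurable_fun [set: T] (st f).
  by move=> mf; apply: measurable_sum => j; apply: measurable_indic; exact: mA.
have st0 (f : T -> R) w : 0 <= st f w by apply: sumr_ge0 => j _; rewrite indicE ler0n.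
have cst_le (f : T -> R) w : 0 <= f w <= W -> 0 <= c * st f w <= W.
  move=> fW; have /andP[h1 _] := stP f w fW.
  by rewrite mulr_ge0 ?(ltW c0)//= (le_trans h1)//; case/andP: fW.
have intst (f : T -> R) : measurable_fun [set: T] f ->
    \int[P]_w st f w = \sum_(j < N) fine (P (A f j)).
  move=> mf; rewrite (Rintegral_sum measurableT) => [|j _]; last exact/integrable_indic/mA.
  by apply: eq_bigr => j _; rewrite /Rintegral integral_indic ?setIT//; exact: mA.
have intst2 : \int[P]_w (st X w * st Y w) =
    \sum_(j < N) \sum_(l < N) fine (P (A X j `&` A Y l)).
  have mXY j l : measurable (A X j `&` A Y l) by apply: measurableI; exact: mA.
  have -> : \int[P]_w (st X w * st Y w) =
      \int[P]_w (\sum_(j < N) \sum_(l < N) \1_(A X j `&` A Y l) w).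
    apply: eq_Rintegral => w _; rewrite /st big_distrlr/=.
    by apply: eq_bigr => j _; apply: eq_bigr => l _; rewrite indicI.
  rewrite (Rintegral_sum measurableT) => [|j _]; last first.
    by apply: (integrable_sumr measurableT) => l _; exact: integrable_indic.
  apply: eq_bigr => j _; rewrite (Rintegral_sum measurableT) => [|l _];
    last exact: integrable_indic.
  by apply: eq_bigr => l _; rewrite /Rintegral integral_indic ?setIT.
(* There are [N * N] pairs of levels, each with a gap of at most [a], and [c * N = W]. *)
have covst : `|c ^+ 2 * (\int[P]_w (st X w * st Y w) -
    (\int[P]_w st X w) * (\int[P]_w st Y w))| <= W ^+ 2 * a.
  rewrite intst2 !intst// big_distrlr/= -sumrB normrM.
  under eq_bigr do rewrite -sumrB.
  rewrite ger0_norm ?sqr_ge0// -cN exprMn -[leRHS]mulrA ler_wpM2l ?sqr_ge0//.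
  rewrite expr2 -mulrA -[X in _ <= X%:R * _](card_ord N) mulr_natl -sumr_const.
  apply: (le_trans (ler_norm_sum _ _ _)); apply: ler_sum => j _.
  rewrite -[X in _ <= X%:R * _](card_ord N) mulr_natl -sumr_const.
  by apply: (le_trans (ler_norm_sum _ _ _)); apply: ler_sum => l _; exact: Pa.
have [iX X1] := int_bnd mX X0; have [iY Y1] := int_bnd mY Y0.
pose X' w := c * st X w; pose Y' w := c * st Y w.
have X'0 w : 0 <= X' w <= W by exact: cst_le.
have Y'0 w : 0 <= Y' w <= W by exact: cst_le.
have mX' : measurable_fun [set: T] X' by apply: measurable_funM => //; exact: mst.
have mY' : measurable_fun [set: T] Y' by apply: measurable_funM => //; exact: mst.
have [iX' X'1] := int_bnd mX' X'0; have [iY' Y'1] := int_bnd mY' Y'0.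
have ist (f : T -> R) : measurable_fun [set: T] f ->
    P.-integrable [set: T] (EFin \o st f).
  by move=> mf; apply: (integrable_sumr measurableT) => j _; exact/integrable_indic/mA.
have prod_int (f g : T -> R) (K : R) : measurable_fun [set: T] f ->
    measurable_fun [set: T] g -> (forall w, 0 <= f w <= K) ->
    (forall w, 0 <= g w <= K) ->
    P.-integrable [set: T] (EFin \o (fun w => f w * g w)).
  move=> mf mg fK gK.
  have [//|w|//] := @int_bnd (fun w => f w * g w) (K * K); first exact: measurable_funM.
  have /andP[f0 f1] := fK w; have /andP[g0 g1] := gK w.
  by rewrite mulr_ge0//= ler_pM.
have stK (f : T -> R) w : 0 <= f w <= W -> 0 <= st f w <= c^-1 * W.
  by move=> /cst_le /andP[h1 h2]; rewrite st0 ler_pdivlMl.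
have EX' : \int[P]_w X' w = c * \int[P]_w st X w.
  by rewrite RintegralZl//; exact: ist.
have EY' : \int[P]_w Y' w = c * \int[P]_w st Y w.
  by rewrite RintegralZl//; exact: ist.
have EXY' : \int[P]_w (X' w * Y' w) = c ^+ 2 * \int[P]_w (st X w * st Y w).
  rewrite -RintegralZl//; last first.
    by apply: (prod_int _ _ (c^-1 * W)) => [||w|w]; [exact: mst|exact: mst|exact: stK..].
  by apply: eq_Rintegral => w _; rewrite mulrACA -expr2.
have close (f f' : T -> R) : P.-integrable [set: T] (EFin \o f) ->
    P.-integrable [set: T] (EFin \o f') -> (forall w, f' w <= f w <= f' w + c) ->
    \int[P]_w f' w <= \int[P]_w f w <= \int[P]_w f' w + c.
  move=> fi f'i ff'.
  have ic : P.-integrable [set: T] (EFin \o cst c).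
    exact: finite_measure_integrable_cst.
  rewrite le_Rintegral//=; last by move=> w _; have /andP[] := ff' w.
  rewrite -[X in _ <= _ + X](Rintegral_cst_probability P) -RintegralD//.
  apply: le_Rintegral => //; first exact: (integrableD _ f'i ic).
  by move=> w _; have /andP[] := ff' w.
have D2 : 0 <= \int[P]_w X w * \int[P]_w Y w - \int[P]_w X' w * \int[P]_w Y' w <= 2 * W * c.
  apply: product_approx.
  - by apply: close => // w; exact: stP.
  - by apply: close => // w; exact: stP.
  - by case/andP : X'1.
  - by case/andP : Y'1.
  - by case/andP : X1.
  - by case/andP : Y1.
have D1 : 0 <= \int[P]_w (X w * Y w) - \int[P]_w (X' w * Y' w) <= 2 * W * c.
  have iXY := prod_int _ _ _ mX mY X0 Y0.
  have iXY' := prod_int _ _ _ mX' mY' X'0 Y'0.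
  rewrite -RintegralB//.
  have [||//] := @int_bnd (fun w => X w * Y w - X' w * Y' w) (2 * W * c).
    by apply: measurable_funB; exact: measurable_funM.
  move=> w; apply: product_approx; [exact: stP|exact: stP|..].
  - by case/andP : (X'0 w).
  - by case/andP : (Y'0 w).
  - by case/andP : (X0 w).
  - by case/andP : (Y0 w).
move: covst; rewrite mulrBr -EXY' expr2 mulrACA -EX' -EY' => covst.
have -> : \int[P]_w (X w * Y w) - \int[P]_w X w * \int[P]_w Y w =
  (\int[P]_w (X' w * Y' w) - \int[P]_w X' w * \int[P]_w Y' w) +
  ((\int[P]_w (X w * Y w) - \int[P]_w (X' w * Y' w)) -
   (\int[P]_w X w * \int[P]_w Y w - \int[P]_w X' w * \int[P]_w Y' w)) by ring.
apply: (le_trans (ler_normD _ _)); apply: lerD => //.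
apply: le_trans Ne.
move: D1 D2; move: (_ - _) (_ - _) => x y; rewrite ler_norml; clear; lra.
Qed.

(** Adding [U] to both variables makes them nonnegative with range [2 * U], and changes neither the
    covariance nor the family of superlevel events; hence [4 * U ^+ 2]. *)
Lemma covariance_le (X Y : T -> R) (U a : R) : 0 < U ->
  measurable_fun [set: T] X -> measurable_fun [set: T] Y ->
  (forall w, `|X w| <= U) -> (forall w, `|Y w| <= U) ->
  (forall s t, `|fine (P [set w | t <= X w /\ s <= Y w])
     - fine (P [set w | t <= X w]) * fine (P [set w | s <= Y w])| <= a) ->
  `|\int[P]_w ((X w - \int[P]_w' X w') * (Y w - \int[P]_w' Y w'))|
    <= 4 * U ^+ 2 * a.
Proof.
move=> U0 mX mY XU YU Pa.
have iX : P.-integrable [set: T] (EFin \o X) by exact: integrable_bounded mX XU.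
have iY : P.-integrable [set: T] (EFin \o Y) by exact: integrable_bounded mY YU.
have iXY : P.-integrable [set: T] (EFin \o (fun w => X w * Y w)).
  apply: (@integrable_bounded _ _ _ _ _ (U * U)) => [|w].
    exact: measurable_funM.
  by rewrite normrM ler_pM.
have ic (r : R) : P.-integrable [set: T] (EFin \o cst r).
  exact: finite_measure_integrable_cst.
have iZ (f : T -> R) r : P.-integrable [set: T] (EFin \o f) ->
    P.-integrable [set: T] (EFin \o (fun w => r * f w)).
  by move=> fi; exact: (integrableZl _ r fi).
have iD (f g : T -> R) : P.-integrable [set: T] (EFin \o f) ->
    P.-integrable [set: T] (EFin \o g) ->
    P.-integrable [set: T] (EFin \o (fun w => f w + g w)).
  by move=> fi gi; exact: (integrableD _ fi gi).
have expand p q : \int[P]_w ((X w + p) * (Y w + q)) =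
    \int[P]_w (X w * Y w) + q * \int[P]_w X w + p * \int[P]_w Y w + p * q.
  have -> : \int[P]_w ((X w + p) * (Y w + q)) =
      \int[P]_w (X w * Y w + q * X w + p * Y w + p * q).
    by apply: eq_Rintegral => w _; ring.
  rewrite (RintegralD _ _ (ic _))//; last by apply/iD; [apply/iD|]; rewrite //; exact: iZ.
  rewrite Rintegral_cst_probability RintegralD//; [|by apply/iD => //; exact: iZ|exact: iZ].
  by rewrite RintegralD//; [rewrite !RintegralZl|exact: iZ].
have shift (f : T -> R) p : P.-integrable [set: T] (EFin \o f) ->
    \int[P]_w (f w + p) = \int[P]_w f w + p.
  by move=> fi; rewrite (RintegralD measurableT fi (ic p)) Rintegral_cst_probability.
have nonneg (f : T -> R) w : `|f w| <= U -> 0 <= f w + U <= 2 * U.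
  by rewrite ler_norml => /andP[]; clear; lra.
have := @covariance_ge0_le (fun w => X w + U) (fun w => Y w + U) (2 * U) a.
rewrite !shift// !expand.
set e := \int[P]_w (X w * Y w); set p := \int[P]_w X w; set q := \int[P]_w Y w.
have -> : e + - q * p + - p * q + - p * - q =
    e + U * p + U * q + U * U - (p + U) * (q + U) by ring.
have -> : 4 * U ^+ 2 = (2 * U) ^+ 2 by ring.
apply; first by rewrite mulr_gt0.
- exact: measurable_funD.
- exact: measurable_funD.
- by move=> w; exact: nonneg.
- by move=> w; exact: nonneg.
move=> s t; have := Pa (s - U) (t - U).
have E1 (f : T -> R) r : [set w | r <= f w + U] = [set w | r - U <= f w].
  by apply/seteqP; split => w /=; rewrite lerBlDr.
have E2 : [set w | t <= X w + U /\ s <= Y w + U] =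
    [set w | t - U <= X w /\ s - U <= Y w].
  by apply/seteqP; split => w /=; rewrite !lerBlDr.
by rewrite E2 !E1.
Qed.

End covariance.

(** * Graph distances and sums over spheres *)

Section graph_distance.
Context (R : realType) (V : finType) (e : rel V).

Definition distances : seq (\bar R) :=
  rcons [seq (k%:R)%:E | k <- iota 0 #|V|] +oo%E.

Lemma uniq_distances : uniq distances.
Proof.
rewrite rcons_uniq map_inj_uniq ?iota_uniq ?andbT.
  by apply/mapP => -[k _].
by move=> k l [] /eqP; rewrite eqr_nat => /eqP.
Qed.

Lemma gdist_self (u : V) : (gdist R e u u <= 0)%E.
Proof. by apply: ereal_inf_lbound; exists [::]. Qed.

(** A shortest path can be made free of repeated vertices, so it has fewer than [#|V|] edges. *)
Lemma gdist_in_distances (u u' : V) : gdist R e u u' \in distances.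
Proof.
rewrite mem_rcons inE.
have [ex|nex] := pselect (exists k,
    `[< exists2 s, path e u s /\ last u s = u' & size s = k >]); last first.
  apply/orP; left; rewrite /gdist (_ : [set _ | _ in _] = set0) ?ereal_inf0//.
  apply/seteqP; split => // _ [s [us su'] <-]; apply: nex.
  by exists (size s); apply/asboolP; exists s.
apply/orP; right.
have [m /asboolP[s [us su'] sm] mmin] := ex_minnP ex.
have -> : gdist R e u u' = m%:R%:E.
  apply/eqP; rewrite eq_le; apply/andP; split.
    by apply: ereal_inf_lbound; exists s => //; rewrite sm.
  apply: le_ereal_inf_tmp => _ [s' [us' s'u'] <-]; rewrite lee_fin ler_nat.
  by apply: mmin; apply/asboolP; exists s'.
apply/mapP; exists m => //; rewrite mem_iota/= add0n.
case/shortenP: us su' => s' us' uniqs' _ s'u'.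
apply: (@leq_ltn_trans (size s')).
  by apply: mmin; apply/asboolP; exists s'.
rewrite -[X in (X <= _)%N]/(size (u :: s')) -(card_uniqP uniqs').
exact: max_card.
Qed.

(** Every pair of vertices lies on exactly one sphere because [distances] is exhaustive and free of
    repetitions; [radii] drops only empty spheres. *)
Lemma sum_over_spheres (B : {set V}) (g : \bar R -> R) :
  \sum_(u in B) \sum_(u' in B) g (gdist R e u u') =
  \sum_(rho <- radii R e B) #|sphere e B rho|%:R * g rho.
Proof.
rewrite /radii big_filter [RHS]big_mkcond/=.
rewrite -/distances.
transitivity (\sum_(rho <- distances) \sum_(ij in sphere e B rho) g rho); last first.
  apply: eq_bigr => rho _; rewrite sumr_const mulr_natl.
  by case: posnP => // ->.
rewrite pair_big/=; under [RHS]eq_bigr do rewrite big_mkcond/=.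
rewrite exchange_big/= [LHS]big_mkcond/=; apply: eq_bigr => -[u u'] _.
have sphereE rho : ((u, u') \in sphere e B rho) =
    [&& u \in B, u' \in B & gdist R e u u' == rho].
  by rewrite inE finset.in_setX -andbA.
under [RHS]eq_bigr do rewrite sphereE.
case: ifPn => /= [/andP[uB u'B]|uB]; last first.
  by rewrite big1// => rho _; rewrite andbA (negbTE uB).
rewrite (bigD1_seq (gdist R e u u')) ?gdist_in_distances ?uniq_distances//=.
rewrite uB u'B eqxx/= big1 ?addr0// => rho /negbTE rg.
by rewrite eq_sym rg.
Qed.

End graph_distance.

(** * Mixing coefficients within a block *)

Section within_block_dependence.
Context d (T : measurableType d) (R : realType) (P : probability T R).
Context dZ (Z : measurableType dZ) (V : finType) (e : rel V) (X : V -> T -> Z).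
Hypothesis mX : forall u, measurable_fun [set: T] (X u).
Context (F : set (Z -> R)).
Hypothesis F0 : F (fun=> 0).
Hypothesis F_meas : forall f, F f -> measurable_fun [set: Z] f.

Lemma superlevel_gap_le1 (f g : T -> R) s t :
  measurable_fun [set: T] f -> measurable_fun [set: T] g ->
  `|fine (P [set w | t <= f w /\ s <= g w])
    - fine (P [set w | t <= f w]) * fine (P [set w | s <= g w])| <= 1.
Proof.
move=> mf mg.
have gap (x y : R) : 0 <= x <= 1 -> 0 <= y <= 1 -> `|x - y| <= 1.
  by move=> /andP[x0 x1] /andP[y0 y1]; rewrite ler_norml; apply/andP; split;
    [rewrite lerBrDr (le_trans _ x0)// addrC subr_le0|
     rewrite lerBlDr (le_trans x1)// lerDl].
have P01 A : measurable A -> 0 <= fine (P A) <= 1.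
  move=> mA; rewrite fine_ge0//= -lee_fin fineK ?probability_le1//.
  exact: fin_num_measure.
have mf' := measurable_superlevel t mf; have mg' := measurable_superlevel s mg.
have /andP[b0 b1] := P01 _ mf'; have /andP[c0 c1] := P01 _ mg'.
apply: gap; first exact: P01 (measurableI _ _ mf' mg').
by rewrite mulr_ge0//= mulr_ile1.
Qed.

Lemma superlevel_gap_le_alpha (f g : T -> R) s t :
  measurable_fun [set: T] f -> measurable_fun [set: T] g ->
  `|fine (P [set w | t <= f w /\ s <= g w])
    - fine (P [set w | t <= f w]) * fine (P [set w | s <= g w])| <= alpha P f g.
Proof.
move=> mf mg; rewrite /alpha; set S := (S in sup S).
have ubS : has_ubound S.
  by exists 1 => _ [s' [t' ->]]; exact: superlevel_gap_le1.
set x := `|_|; have Sx : x <= sup S by apply: ub_le_sup => //; exists s, t.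
by rewrite mulr_natl mulr2n (le_trans Sx)// lerDl (le_trans _ Sx)// /x normr_ge0.
Qed.

Lemma alpha_bounds (f g : T -> R) :
  measurable_fun [set: T] f -> measurable_fun [set: T] g -> 0 <= alpha P f g <= 2.
Proof.
move=> mf mg; rewrite (le_trans _ (superlevel_gap_le_alpha 0 0 mf mg))//=.
rewrite /alpha -[leRHS]mulr1 ler_pM2l//; apply: ge_sup.
  by eexists; exists 0, 0.
by move=> _ [s [t ->]]; exact: superlevel_gap_le1.
Qed.

Let mdiff f u : diff_class F f -> measurable_fun [set: T] (f \o X u).
Proof.
move=> [f1 [f2 [/F_meas m1 /F_meas m2 ->]]].
by apply: measurableT_comp => //; exact: measurable_funB.
Qed.

Let alpha_set (B : {set V}) rho := [set a | exists f i j,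
  [/\ diff_class F f, i \in B, j \in B, (rho <= gdist R e i j)%E &
      a = alpha P (f \o X i) (f \o X j)]].

Let alpha_set_bounds B rho x : alpha_set B rho x -> 0 <= x <= 2.
Proof.
by move=> [f [i [j [Ff _ _ _ ->]]]]; apply: alpha_bounds; exact: mdiff.
Qed.

(** The 2 comes from the factor in [alpha]. It matters below, where these numbers are compared with
    their powers and with a variable confined to [[0, 1]]. *)
Lemma alpha_block_bounds (B : {set V}) rho :
  0 <= alpha_block P e X F B rho <= 2.
Proof.
rewrite /alpha_block; case: ifPn => // _; first by rewrite ler01 ler1n.
case: ifPn => _; first by rewrite lexx ler0n.
change (0 <= sup (alpha_set B rho) <= 2).
have [->|/set0P[x Sx]] := eqVneq (alpha_set B rho) set0; first by rewrite sup0 lexx ler0n.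
apply/andP; split.
  have /andP[x0 _] := alpha_set_bounds Sx; apply: (le_trans x0).
  by apply: ub_le_sup => //; exists 2 => y /alpha_set_bounds /andP[].
by apply: ge_sup; [exists x|move=> y /alpha_set_bounds /andP[]].
Qed.

Hypothesis X_indep : forall A B : {set V}, (A :&: B)%SET = finset.set0 ->
  gdist_set R e A B = +oo%E ->
  indep_systems P (sigma_field X A) (sigma_field X B).

(** At distance 0 the convention gives 1, which bounds any gap; at infinite distance independence
    makes the gap vanish; in between, [F0] writes [f] as [f - 0], a member of the difference
    class. *)
Lemma superlevel_gap_le_alpha_block (B : {set V}) f u u' s t :
  F f -> u \in B -> u' \in B ->
  `|fine (P [set w | t <= f (X u w) /\ s <= f (X u' w)])
    - fine (P [set w | t <= f (X u w)]) * fine (P [set w | s <= f (X u' w)])|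
  <= alpha_block P e X F B (gdist R e u u').
Proof.
move=> Ff uB u'B; have mf := F_meas Ff.
have mfX w : measurable_fun [set: T] (f \o X w) by exact: measurableT_comp.
rewrite /alpha_block; case: ifPn => [_|rho0].
  exact: (@superlevel_gap_le1 (f \o X u) (f \o X u')).
case: ifPn => [/eqP dy|rhoy]; last first.
  have dFf : diff_class F f.
    by exists f, (fun=> 0); split => //; apply/funext => z /=; rewrite subr0.
  apply: (le_trans (@superlevel_gap_le_alpha (f \o X u) (f \o X u') s t _ _)) => //.
  apply: ub_le_sup; last by exists f, u, u'.
  by exists 2 => y /alpha_set_bounds /andP[].
(* Independence is assumed for disjoint sets of vertices; two equal vertices would be at distance at
   most 0, not [+oo]. *)
have uu' : u != u'.
  apply: contra_eqN dy => /eqP <-; rewrite lt_eqF//.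
  exact: (le_lt_trans (gdist_self R e u)).
have lev x r : sigma_field X [set x]%SET [set w | r <= f (X x w)].
  apply: sub_sigma_algebra; exists x; first by rewrite inE.
  exists [set z | r <= f z]; last by rewrite setTI.
  exact: measurable_superlevel.
have := X_indep _ _ (lev u t) (lev u' s).
rewrite /setI/= => ->.
- rewrite fineM ?subrr ?normr0//; apply: fin_num_measure;
  exact: (measurable_superlevel _ (mfX _)).
- by apply/setP => x; rewrite !inE; apply/negP => /andP[/eqP -> /eqP uu]; rewrite uu eqxx in uu'.
- rewrite /gdist_set (_ : [set _ | _] = [set +oo%E]) ?ereal_inf1//.
  apply/seteqP; split => [_ [i [j [/set1P -> /set1P -> ->]]]//|_ ->/=].
  by exists u, u'; rewrite !inE.
Qed.

End within_block_dependence.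

(** * Variance of a block sum *)

Section variance.
Context d (T : measurableType d) (R : realType) (P : probability T R).
Context dZ (Z : measurableType dZ) (V : finType) (e : rel V) (X : V -> T -> Z).
Hypothesis mX : forall u, measurable_fun [set: T] (X u).
Context (F : set (Z -> R)).
Hypothesis F0 : F (fun=> 0).
Hypothesis F_meas : forall f, F f -> measurable_fun [set: Z] f.
Hypothesis X_indep : forall A B : {set V}, (A :&: B)%SET = finset.set0 ->
  gdist_set R e A B = +oo%E ->
  indep_systems P (sigma_field X A) (sigma_field X B).
Context (U : R) (U0 : 0 < U).
Hypothesis F_le : forall f z, F f -> `|f z| <= U.

(** This is the square of [Gamma_sum] at [p = +oo], the form in which bounded functions produce
    it. *)
Definition dependence_sum (B : {set V}) : R :=
  \sum_(rho <- radii R e B) sphere_weight e B rho * alpha_block P e X F B rho.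

(** The square expands into covariances of pairs, each controlled by the distance of the pair;
    grouping by distance gives the spheres, and [#|B|] undoes the division in [sphere_weight]. *)
Lemma block_variance_le (I : finType) (h : I -> Z -> R) (B : {set V}) i :
  F (h i) -> (0 < #|B|)%N ->
  \int[P]_w (block_sum P X h B i w) ^+ 2 <=
    4 * U ^+ 2 * (#|B|%:R * dependence_sum B).
Proof.
move=> Fh B0.
pose f := h i.
have mfX u : measurable_fun [set: T] (fun w => f (X u w)).
  by apply: measurableT_comp => //; exact: F_meas.
have fU u w : `|f (X u w)| <= U by exact: F_le.
pose g u w := f (X u w) - \int[P]_w' f (X u w').
have mg u : measurable_fun [set: T] (g u) by exact: measurable_funB.
have gU u w : `|g u w| <= U + `|\int[P]_w' f (X u w')|.
  by rewrite (le_trans (ler_normB _ _))// lerD2r.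
have ig u u' : P.-integrable [set: T] (EFin \o (fun w => g u w * g u' w)).
  apply: (@integrable_bounded _ _ _ _ _ ((U + `|\int[P]_w' f (X u w')|) *
      (U + `|\int[P]_w' f (X u' w')|))) => [|w]; first exact: measurable_funM.
  by rewrite normrM ler_pM.
have -> : \int[P]_w (block_sum P X h B i w) ^+ 2 =
    \int[P]_w (\sum_(u in B) \sum_(u' in B) g u w * g u' w).
  by apply: eq_Rintegral => w _; rewrite expr2 /block_sum big_distrlr.
rewrite (Rintegral_sum measurableT)// => [|u _];
  last by apply: (integrable_sumr measurableT) => // u' _.
under eq_bigr => u _ do rewrite (Rintegral_sum measurableT)//.
rewrite /dependence_sum; under [X in _ * (_ * X)]eq_bigr => rho _ do
  rewrite /sphere_weight mulrAC.
rewrite -mulr_suml [X in _ * X]mulrCA divff ?pnatr_eq0 -?lt0n// mulr1.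
rewrite -(@sum_over_spheres R V e B (alpha_block P e X F B)) mulr_sumr.
apply: ler_sum => u uB; rewrite mulr_sumr; apply: ler_sum => u' u'B.
apply: (le_trans (ler_norm _)); apply: covariance_le => // s t.
exact: superlevel_gap_le_alpha_block.
Qed.

(** Half of [x] lies in [[0, 1]], where an exponent at most 1 can only increase it. *)
Lemma le_powR_half (x th : R) : 0 <= x <= 2 -> 0 < th <= 1 -> x <= 2 * x `^ th.
Proof.
move=> /andP[x0 x2] /andP[th0 th1].
rewrite le_eqVlt in x0; case/orP: x0 => [/eqP <-|x0].
  by rewrite powR0 ?mulr0// lt0r_neq0.
rewrite -ler_pdivrMl//.
have x1 : 0 < 2^-1 * x <= 1 by rewrite mulr_gt0// ler_pdivrMl// mulr1.
apply: (@le_trans _ _ ((2^-1 * x) `^ th)).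
  by have := ger_powR x1 th1; rewrite powRr1// ltW//; case/andP: x1.
have h0 : 0 <= 2^-1 * x by case/andP: x1 => /ltW.
apply: ge0_ler_powR; rewrite ?nnegrE//; [exact: ltW|exact: ltW|].
by rewrite ler_pdivrMl// mulr_natl mulr2n lerDl ltW.
Qed.

End variance.

(** If [x] exceeds [c], then [x / c] is at least 1 and at most its [q]-th power. Integrated and
    optimised in [c], this replaces Hölder's inequality at the price of a factor 2. *)
Lemma le_add_powR (R : realType) (x c q : R) : 0 <= x -> 0 < c -> 1 <= q ->
  x <= c + c / c `^ q * x `^ q.
Proof.
move=> x0 c0 q1; have [xc|cx] := leP x c.
  by rewrite (le_trans xc)// lerDl mulr_ge0 ?powR_ge0// divr_ge0 ?powR_ge0// ltW.
have xE : x = c * (x / c) by rewrite mulrC divfK// lt0r_neq0.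
have xq : x `^ q = c `^ q * (x / c) `^ q.
  by rewrite -powRM ?divr_ge0 ?(ltW c0)// -xE.
have cq0 : c `^ q != 0 by rewrite lt0r_neq0// powR_gt0.
rewrite xq mulrA divfK//; apply: (@le_trans _ _ (c * (x / c) `^ q)); last first.
  by rewrite lerDr ltW.
have cx1 : 1 <= x / c by rewrite ler_pdivlMr// mul1r ltW.
rewrite {1}xE ler_pM2l//; have := ler_powR cx1 q1.
by rewrite powRr1// divr_ge0// ltW.
Qed.

(** * A layer-cake inequality for the sharp factor *)

Section layer_cake.
Context (R : realType) (K : Type) (r : seq K) (w A : K -> R) (th : R).
Hypothesis w0 : forall k, 0 <= w k.
Hypothesis A02 : forall k, 0 <= A k <= 2.
Hypothesis th01 : 0 < th <= 1.

Local Notation mu := (@lebesgue_measure R).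
Let D : set R := `[0, 1].
Let N (u : R) : R := \sum_(k <- r | u <= A k) w k.

Let mD : measurable D. Proof. exact: measurable_itv. Qed.

Let muD : mu D = 1%E.
Proof. by rewrite /D lebesgue_measure_itv/= lte_fin ltr01 sube0. Qed.

Let ray k : set R := [set u | u <= A k].

Let mray k : measurable (ray k).
Proof.
rewrite (_ : ray k = `]-oo, A k]%classic)//.
Qed.

Let NE u : N u = \sum_(k <- r) w k * \1_(ray k) u.
Proof.
rewrite /N big_mkcond; apply: eq_bigr => k _.
have -> : (\1_(ray k) u : R) = (u <= A k)%R%:R by rewrite indicE mem_setE.
by case: (u <= A k); rewrite ?mulr1 ?mulr0.
Qed.

Let mN : measurable_fun D N.
Proof.
rewrite (_ : N = fun u => \sum_(k <- r) w k * \1_(ray k) u); last exact/funext.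
by apply: measurable_sum => k; apply: measurable_funM => //; exact: measurable_indic.
Qed.

Let N0 u : 0 <= N u. Proof. exact: sumr_ge0. Qed.

Let N_le u : N u <= \sum_(k <- r) w k.
Proof.
by rewrite /N big_mkcond; apply: ler_sum => k _; case: ifP.
Qed.

Let integrable_bounded_unit (f : R -> R) (C : R) : measurable_fun D f ->
  (forall u, 0 <= f u <= C) -> mu.-integrable D (EFin \o f).
Proof.
move=> mf fC; apply: measurable_bounded_integrable => //.
  by rewrite [X in (X < _)%E]muD ltey.
exists C; split; first exact: num_real.
move=> y Cy u _ /=; have /andP[f0 f1] := fC u.
by rewrite ger0_norm// (le_trans f1)// ltW.
Qed.

Let iN : mu.-integrable D (EFin \o N).
Proof. by apply: (@integrable_bounded_unit _ (\sum_(k <- r) w k) mN) => u; rewrite N0 N_le. Qed.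

Let iNp : mu.-integrable D (EFin \o (fun u => N u `^ th^-1)).
Proof.
apply: (@integrable_bounded_unit _ ((\sum_(k <- r) w k) `^ th^-1)).
  by apply: (measurableT_comp (measurable_powR _)).
move=> u; rewrite powR_ge0/=; apply: ge0_ler_powR; rewrite ?nnegrE//.
- by rewrite invr_ge0 ltW//; case/andP: th01.
- exact: sumr_ge0.
Qed.

Let half_sum_le : \sum_(k <- r) w k * A k <= 2 * \int[mu]_(u in D) N u.
Proof.
have iind k : mu.-integrable D (EFin \o (\1_(ray k) : R -> R)).
  apply: (@integrable_bounded_unit _ 1); first exact: measurable_indic.
  by move=> u; rewrite indicE; case: (_ \in _); rewrite lexx ler01.
have -> : \int[mu]_(u in D) N u =
    \int[mu]_(u in D) (\sum_(k <- r) w k * \1_(ray k) u).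
  by apply: eq_Rintegral => u _.
rewrite Rintegral_sum// => [|k _]; last exact: (integrableZl _ _ (iind k)).
rewrite mulr_sumr; apply: ler_sum => k _.
rewrite RintegralZl// mulrCA ler_wpM2l//.
rewrite /Rintegral integral_indic//; last exact: mray.
have /andP[A0 A2] := A02 k.
have mrD : measurable (ray k `&` D) by exact: measurableI.
(* [A k] may reach 2 while [u] stops at 1; the interval of half length fits under both limits. *)
have sub : `[0, 2^-1 * A k]%classic `<=` ray k `&` D.
  move=> u; rewrite /ray /D /= !in_itv/= => /andP[-> uA]; split.
    by rewrite (le_trans uA)// ler_pdivrMl// mulr_natl mulr2n lerDl.
  by rewrite (le_trans uA)// ler_pdivrMl// mulr1.
rewrite -ler_pdivrMl// -lee_fin fineK; last first.
  rewrite ge0_fin_numE//; apply: (@le_lt_trans _ _ (mu D)).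
    by apply: le_measure; rewrite ?inE//; exact: subIsetr.
  by rewrite [X in (X < _)%E]muD ltey.
apply: (@le_trans _ _ (mu `[0, 2^-1 * A k]%classic)).
  rewrite lebesgue_measure_itv/= lte_fin; case: ltP => [_|h].
    by rewrite sube0.
  by rewrite lee_fin.
by apply: le_measure; rewrite ?inE.
Qed.

(** One factor 2 is lost in restricting the layers to [[0, 1]], the other in the substitute for
    Hölder's inequality. *)
Lemma layer_cake_le : \sum_(k <- r) w k * A k <=
  4 * (\int[mu]_(u in D) (N u `^ th^-1)) `^ th.
Proof.
apply: (le_trans half_sum_le).
have -> : 4 = 2 * 2 :> R by rewrite -natrM.
rewrite -mulrA ler_pM2l//.
set J := \int[mu]_(u in D) (N u `^ th^-1).
have /andP[th0 th1] := th01.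
have J0 : 0 <= J by apply: Rintegral_ge0 => u _; exact: powR_ge0.
have main c : 0 < c -> \int[mu]_(u in D) N u <= c + c / c `^ th^-1 * J.
  move=> c0.
  have ic : mu.-integrable D (EFin \o cst c).
    by apply: (@integrable_bounded_unit _ c) => // u; rewrite lexx ltW.
  have iZ : mu.-integrable D (EFin \o (fun u => c / c `^ th^-1 * N u `^ th^-1)).
    exact: (integrableZl _ _ iNp).
  rewrite -RintegralZl// -[X in _ <= X + _]mulr1 -[X in _ <= _ * X + _]/(fine 1%E).
  rewrite -muD -Rintegral_cst// -RintegralD//.
  apply: le_Rintegral => //; first exact: (integrableD _ ic iZ).
  by move=> u _; apply: le_add_powR => //; rewrite invf_ge1.
(* The optimal [c] would be 0 when [J = 0]; then every positive [c] is an upper bound, which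
   suffices. *)
rewrite le_eqVlt in J0; case/orP: J0 => [/eqP J0|J0].
  rewrite -J0 powR0 ?lt0r_neq0// mulr0.
  apply/ler_addgt0Pr => c c0; rewrite add0r (le_trans (main c c0))//.
  by rewrite -J0 mulr0 addr0.
(* For [c = J]^ th[one has]c [^ th^-1 = J], so both terms of [main] equal [c]. *)
have := main (J `^ th); rewrite powR_gt0// => /(_ isT).
rewrite -powRrM mulfV ?lt0r_neq0// powRr1 ?(ltW J0)// divfK ?lt0r_neq0//.
by rewrite mulr_natl mulr2n.
Qed.

End layer_cake.

Section Gamma_bound.
Context d (T : measurableType d) (R : realType) (P : probability T R).
Context dZ (Z : measurableType dZ) (V : finType) (e : rel V) (X : V -> T -> Z).
Hypothesis mX : forall u, measurable_fun [set: T] (X u).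
Context (F : set (Z -> R)).
Hypothesis F_meas : forall f, F f -> measurable_fun [set: Z] f.
Context (p : \bar R) (p_ge1 : (1 <= p)%E).

Let A := alpha_block P e X F.

Lemma inv_exponent_ge0 : 0 <= inv_exponent p.
Proof.
rewrite /inv_exponent; case: p p_ge1 => [r| |]//.
by rewrite lee_fin invr_ge0 => /(le_trans ler01).
Qed.

Let conj_exponent_bounds : p != 1%E -> 0 < 1 - inv_exponent p <= 1.
Proof.
move=> p1; rewrite gerBl inv_exponent_ge0 andbT subr_gt0 /inv_exponent.
case: p p_ge1 p1 => [r| |]//; rewrite lee_fin => r1 rn1.
by rewrite invf_lt1 ?(lt_le_trans ltr01)// lt_neqAle r1 eq_sym andbT.
Qed.

Let weight_ge0 (B : {set V}) rho : 0 <= sphere_weight (R := R) e B rho.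
Proof. by rewrite divr_ge0. Qed.

Lemma dependence_sum_le_Gamma_sum (B : {set V}) :
  dependence_sum P e X F B <= 2 * Gamma_sum P e X F p B ^+ 2.
Proof.
rewrite /Gamma_sum; case: ifPn => [_|p1].
  rewrite sqr_sqrtr; last by apply: sumr_ge0 => rho _.
  rewrite mulr_sumr; apply: ler_sum => rho _; rewrite [leRHS]mulrC ler_wpM2l//.
  by have /andP[] := alpha_block_bounds P e mX F_meas B rho.
rewrite sqr_sqrtr; last by apply: sumr_ge0 => rho _; rewrite mulr_ge0 ?powR_ge0.
rewrite mulr_sumr; apply: ler_sum => rho _; rewrite mulrCA ler_wpM2l//.
by apply: le_powR_half; [exact: alpha_block_bounds|exact: conj_exponent_bounds].
Qed.

Lemma dependence_sum_le_Gamma_sharp (B : {set V}) :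
  dependence_sum P e X F B <= 4 * Gamma_sharp P e X F p B ^+ 2.
Proof.
rewrite /Gamma_sharp; case: ifPn => [p1|p1].
  apply: (le_trans (dependence_sum_le_Gamma_sum B)); rewrite /Gamma_sum p1.
  by rewrite ler_wpM2r ?sqr_ge0// ler_nat.
rewrite sqr_sqrtr ?powR_ge0//.
apply: layer_cake_le => //; last exact: conj_exponent_bounds.
by move=> rho; exact: alpha_block_bounds.
Qed.

Lemma Gamma_sum_ge0 (B : {set V}) : 0 <= Gamma_sum P e X F p B.
Proof. by rewrite /Gamma_sum; case: ifP => _; exact: sqrtr_ge0. Qed.

Lemma Gamma_sharp_ge0 (B : {set V}) : 0 <= Gamma_sharp P e X F p B.
Proof. by rewrite /Gamma_sharp; case: ifP => _; exact: sqrtr_ge0. Qed.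

(** Whichever term attains the minimum bounds the sum. In the sharp case the power of [#|B|] is at
    least 1, since the block is nonempty, so [Gamma_sharp] itself is at most [g]. *)
Lemma dependence_sum_le_Gamma (B : {set V}) g : (0 < #|B|)%N ->
  Gamma P e X F p B <= g -> dependence_sum P e X F B <= 4 * g ^+ 2.
Proof.
move=> B0; rewrite /Gamma; set c : R := #|B|%:R `^ _ => mg.
have c1 : 1 <= c.
  rewrite -(powRr0 #|B|%:R) /c ler_powR ?ler1n//.
  by rewrite divr_ge0// inv_exponent_ge0.
have sq (x : R) : 0 <= x -> x <= g -> 4 * x ^+ 2 <= 4 * g ^+ 2.
  by move=> x0 xg; rewrite ler_pM2l// lerXn2r// nnegrE// (le_trans x0).
case: (leP (Gamma_sum P e X F p B) (Gamma_sharp P e X F p B * c)) mg => _ mg.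
  apply: (le_trans (dependence_sum_le_Gamma_sum B)).
  apply: le_trans (sq _ (Gamma_sum_ge0 B) mg).
  by rewrite ler_wpM2r ?sqr_ge0// ler_nat.
apply: (le_trans (dependence_sum_le_Gamma_sharp B)).
apply: sq; first exact: Gamma_sharp_ge0.
by apply: le_trans mg; rewrite ler_peMr// Gamma_sharp_ge0.
Qed.

End Gamma_bound.

(** * From representatives to the whole class *)

Lemma markov_Rintegral d (T : measurableType d) (R : realType)
    (P : probability T R) (H : T -> R) (eps : R) : 0 < eps ->
  P.-integrable [set: T] (EFin \o H) -> (forall w, 0 <= H w) ->
  (P [set w | (eps <= H w)%R] <= (eps^-1 * \int[P]_w H w)%:E)%E.
Proof.
move=> eps0 iH H0.
have mH : measurable_fun [set: T] H by apply/measurable_EFinP; exact: measurable_int iH.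
have mA : measurable [set w | eps <= H w] by exact: measurable_superlevel.
have iA := integrable_indic P mA.
rewrite -(@fineK _ (P _)) ?fin_num_measure// lee_fin ler_pdivlMl//.
have -> : fine (P [set w | eps <= H w]) = \int[P]_w \1_[set w | eps <= H w] w.
  by rewrite /Rintegral integral_indic// setIT.
rewrite -RintegralZl//; apply: le_Rintegral => //.
  exact: (integrableZl _ _ iA).
move=> w _; rewrite indicE; case: (boolP (w \in _)) => [/set_mem/= h|_].
  by rewrite mulr1.
by rewrite mulr0.
Qed.

Lemma outer_expectation_ge0 d (T : measurableType d) (R : realType)
    (P : probability T R) (h : T -> \bar R) :
  (forall w, 0 <= h w)%E -> (0 <= outer_expectation P h)%E.
Proof.
move=> h0; apply: le_ereal_inf_tmp => _ [g [mg hg] <-].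
by apply: integral_ge0 => w _; exact: le_trans (hg w).
Qed.

(** A measurable majorant within [y] of the infimum exists; truncating it at [C] keeps it above [h]
    and makes it bounded and real-valued. *)
Lemma outer_expectation_majorant d (T : measurableType d) (R : realType)
    (P : probability T R) (h : T -> \bar R) (C y : R) :
  (forall w, 0 <= h w <= C%:E)%E -> 0 < y ->
  exists g : T -> R, [/\ measurable_fun [set: T] g,
    forall w, `|g w| <= C, forall w, (h w <= (g w)%:E)%E &
    ((\int[P]_w g w)%:E <= outer_expectation P h + y%:E)%E].
Proof.
move=> hC y0.
have h0 w : (0 <= h w)%E by have /andP[] := hC w.
have hC' w : (h w <= C%:E)%E by have /andP[] := hC w.
have oe0 := outer_expectation_ge0 P h0.
have oefin : outer_expectation P h \is a fin_num.
  rewrite ge0_fin_numE//; apply: (@le_lt_trans _ _ (\int[P]_w C%:E)%E).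
    by apply: ereal_inf_lbound; exists (cst C%:E) => //; split.
  by rewrite integral_cst// [X in (_ * X)%E](probability_setT P) mule1 ltey.
have [_ [g [mg hg] <-] glt] := lb_ereal_inf_adherent y0 oefin.
pose k w := Order.min (g w) C%:E.
have k0 w : (0 <= k w)%E by rewrite le_min (le_trans (h0 w))//= (le_trans (h0 w)).
have kC w : (k w <= C%:E)%E by rewrite ge_min lexx orbT.
have kfin w : k w \is a fin_num.
  by rewrite ge0_fin_numE// (le_lt_trans (kC w))// ltey.
have mk : measurable_fun [set: T] k by exact: measurable_mine.
have mfk : measurable_fun [set: T] (fine \o k) by exact: measurableT_comp.
have fkC w : `|fine (k w)| <= C.
  by rewrite ger0_norm ?fine_ge0// -lee_fin fineK.
exists (fine \o k); split => //.
  by move=> w; rewrite /= fineK// le_min hg hC'.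
rewrite EFin_Rintegral; last exact: integrable_bounded mfk fkC.
apply: le_trans (ltW glt); apply: ge0_le_integral => //.
- by move=> w _; rewrite lee_fin; exact: fine_ge0 (k0 w).
- exact/measurable_EFinP.
- by move=> w _; rewrite /= (fineK (kfin w)) ge_min lexx.
Qed.

(** Replacing [f] by the representative of its cell costs the average diameter [G] at the sample
    point and its mean under [P]. These bounds do not depend on [f], so the measurable function [H]
    dominates the whole supremum. *)
Lemma class_deviation d (T : measurableType d) (R : realType)
    (P : probability T R) dZ (Z : measurableType dZ) (V : finType)
    (X : V -> T -> Z) (F : set (Z -> R)) (U : R) (Q : nat)
    (C : 'I_Q -> set (Z -> R)) (pi : 'I_Q -> Z -> R) (k0 : 'I_Q)
    (Psi : T -> R) (x y eps : R) :
  (forall u, measurable_fun [set: T] (X u)) -> (0 < #|V|)%N ->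
  (forall f, F f -> measurable_fun [set: Z] f) ->
  (forall f z, F f -> `|f z| <= U) ->
  (forall f, F f -> exists k, C k f) -> (forall k f, C k f -> F f) ->
  (forall k, C k (pi k)) ->
  P.-integrable [set: T] (EFin \o Psi) ->
  (forall k w, `|#|V|%:R^-1 * \sum_u (pi k (X u w) - \int[P]_w' pi k (X u w'))|
     <= Psi w) ->
  \int[P]_w Psi w <= x -> 0 < y -> 0 < eps ->
  ((#|V|%:R^-1)%:E * (\sum_u outer_expectation P
     (fun w => ereal_sup [set diam (C k) (X u w) | k in [set: 'I_Q]])) <= y%:E)%E ->
  (mu_ext P [set w | eps%:E < ereal_sup
      [set `|#|V|%:R^-1 * \sum_u (f (X u w) - fine 'E_P[f \o X u])|%R%:E
         | f in F]] <= (eps^-1 * (x + 4 * y))%:E)%E.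
Proof.
move=> mX V0 F_meas FU Fcov CF Cpi iPsi PsiP Psix y0 eps0 diamy.
set n : R := #|V|%:R.
have n0 : 0 < n by rewrite ltr0n.
pose D u w := ereal_sup [set diam (C k) (X u w) | k in [set: 'I_Q]].
have diam_le k f f' z : C k f -> C k f' -> (`|f z - f' z|%:E <= diam (C k) z)%E.
  by move=> Cf Cf'; apply: ereal_sup_ubound; exists f, f'.
have D_le k f f' u w : C k f -> C k f' -> (`|f (X u w) - f' (X u w)|%:E <= D u w)%E.
  move=> Cf Cf'; apply: (le_trans (diam_le k f f' _ Cf Cf')).
  by apply: ereal_sup_ubound; exists k.
have D_bounds u w : (0 <= D u w <= (2 * U)%:E)%E.
  apply/andP; split.
    apply: le_trans (D_le k0 (pi k0) (pi k0) u w (Cpi k0) (Cpi k0)).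
    by rewrite lee_fin.
  apply: ge_ereal_sup => _ [k _ <-]; apply: ge_ereal_sup => _ [f [f' [Cf Cf' ->]]].
  rewrite lee_fin (le_trans (ler_normB _ _))// mulr_natl mulr2n.
  by rewrite lerD// FU//; [exact: CF Cf|exact: CF Cf'].
have [g gP] := choice (fun u => outer_expectation_majorant P (D_bounds u) y0).
have gm u : measurable_fun [set: T] (g u) by have [] := gP u.
have gU u w : `|g u w| <= 2 * U by have [] := gP u.
have ig u : P.-integrable [set: T] (EFin \o g u).
  exact: integrable_bounded (gm u) (gU u).
have g_le k f f' u w : C k f -> C k f' -> `|f (X u w) - f' (X u w)| <= g u w.
  move=> Cf Cf'; rewrite -lee_fin; apply: le_trans (D_le k f f' u w Cf Cf') _.
  by have [_ _ h _] := gP u.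
have g0 u w : 0 <= g u w.
  by rewrite (le_trans _ (g_le k0 (pi k0) (pi k0) u w (Cpi k0) (Cpi k0))).
pose G w := n^-1 * \sum_u g u w.
have iG : P.-integrable [set: T] (EFin \o G).
  apply: (integrableZl measurableT (n^-1) (f := EFin \o (fun w => \sum_u g u w))).
  by apply: integrable_sumr => // u _.
have GE : \int[P]_w G w = n^-1 * \sum_u \int[P]_w g u w.
  rewrite RintegralZl//; last by apply: integrable_sumr => // u _.
  by rewrite Rintegral_sum.
have G0 w : 0 <= G w by rewrite mulr_ge0 ?invr_ge0 ?(ltW n0)// sumr_ge0.
(* One [y] is the hypothesis on the diameters, the other the slack of the majorants. *)
have Gy : \int[P]_w G w <= 2 * y.
  rewrite GE -lee_fin EFinM.
  apply: (@le_trans _ _ ((n^-1)%:E * (\sum_u outer_expectation P (D u) + (n * y)%:E))%E).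
    rewrite lee_pmul2l// ?lte_fin ?invr_gt0// -sumEFin.
    have -> : (n * y)%:E = (\sum_(u : V) y%:E)%E :> \bar R.
      by rewrite sumEFin sumr_const mulr_natl.
    by rewrite -big_split/=; apply: lee_sum => u _; have [] := gP u.
  have oS0 : (0 <= \sum_u outer_expectation P (D u))%E.
    apply: sume_ge0 => u _; apply: outer_expectation_ge0 => w.
    by have /andP[] := D_bounds u w.
  have ny0 : (0 <= (n * y)%:E)%E by rewrite lee_fin mulr_ge0 ?ltW.
  rewrite (ge0_muleDr _ oS0 ny0).
  have -> : 2 * y = y + y by rewrite mulr_natl mulr2n.
  rewrite EFinD; apply: leeD => //.
  by rewrite -EFinM mulKf// lt0r_neq0.
pose H w := Psi w + (G w + \int[P]_w' G w').
have ic : P.-integrable [set: T] (EFin \o cst (\int[P]_w' G w')).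
  exact: finite_measure_integrable_cst.
have iG2 : P.-integrable [set: T] (EFin \o (fun w => G w + \int[P]_w' G w')).
  exact: (integrableD _ iG ic).
have iH : P.-integrable [set: T] (EFin \o H) by exact: (integrableD _ iPsi iG2).
have IG0 : 0 <= \int[P]_w' G w' by apply: Rintegral_ge0.
have H0 w : 0 <= H w.
  by rewrite addr_ge0 ?addr_ge0// (le_trans _ (PsiP k0 w)).
have Hle : \int[P]_w H w <= x + 4 * y.
  rewrite RintegralD// (RintegralD measurableT iG ic).
  rewrite Rintegral_cst_probability lerD//.
  have -> : 4 * y = 2 * y + 2 * y by ring.
  exact: (lerD Gy Gy).
have mH : measurable_fun [set: T] H by apply/measurable_EFinP; exact: measurable_int iH.
have mA : measurable [set w | eps <= H w] by exact: measurable_superlevel.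
apply: (@le_trans _ _ (P [set w | eps <= H w])); last first.
  apply: (le_trans (markov_Rintegral eps0 iH H0)).
  by rewrite lee_fin ler_pM2l ?invr_gt0.
(* The event of interest may fail to be measurable; its outer measure is bounded through the
   measurable event that contains it. *)
rewrite -(measurable_mu_extE P mA); apply: le_mu_ext => w /= /lt_le_trans lt_sup.
rewrite -lee_fin ltW//; apply: lt_sup; apply: ge_ereal_sup => _ [f Ff <-].
rewrite lee_fin; have [k Ckf] := Fcov f Ff.
have ifX (h : Z -> R) u : F h -> P.-integrable [set: T] (EFin \o (fun w => h (X u w))).
  move=> Fh; apply: (@integrable_bounded _ _ _ _ _ U) => [|w']; last exact: FU.
  by apply: measurableT_comp => //; exact: F_meas.
have -> : n^-1 * \sum_u (f (X u w) - fine 'E_P[f \o X u]) =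
  n^-1 * (\sum_u (pi k (X u w) - \int[P]_w' pi k (X u w'))) +
  (n^-1 * (\sum_u (f (X u w) - pi k (X u w))) -
   n^-1 * (\sum_u \int[P]_w' (f (X u w') - pi k (X u w')))).
  rewrite -mulrBr -mulrDr -sumrB -big_split/=; congr (_ * _).
  apply: eq_bigr => u _; rewrite RintegralB//; [|exact: ifX|exact/ifX/CF].
  by rewrite unlock -/(Rintegral P setT (fun w => f (X u w))); ring.
rewrite (le_trans (ler_normD _ _))// lerD//.
rewrite (le_trans (ler_normB _ _))// lerD//.
  rewrite normrM gtr0_norm ?invr_gt0// ler_pM2l ?invr_gt0//.
  rewrite (le_trans (ler_norm_sum _ _ _))//; apply: ler_sum => u _.
  exact: g_le Ckf (Cpi k).
rewrite GE normrM gtr0_norm ?invr_gt0// ler_pM2l ?invr_gt0//.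
rewrite (le_trans (ler_norm_sum _ _ _))//; apply: ler_sum => u _.
have ifpi : P.-integrable [set: T] (EFin \o (fun w => f (X u w) - pi k (X u w))).
  apply: (integrableB measurableT (ifX f u Ff) (ifX _ u (CF _ _ (Cpi k)))).
apply: (le_trans (le_normr_Rintegral _ _)) => //.
apply: le_Rintegral => //; first exact: integrable_norm.
by move=> w' _; exact: g_le Ckf (Cpi k).
Qed.

Lemma tau_ge0 d (T : measurableType d) (R : realType) (P : probability T R)
    dS (S : measurableType dS) (dist : S -> S -> \bar R) (G : set (set T))
    (X : T -> S) : (0 <= tau P dist G X)%E.
Proof.
apply: le_ereal_inf_tmp => _ [Y _ <-]; apply: integral_ge0 => w _; exact: abse_ge0.
Qed.

Lemma block_partition_sum (R : realType) (V : finType) (M : nat)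
    (B : 'I_M -> {set V}) (f : V -> R) : block_partition B ->
  \sum_(m < M) \sum_(u in B m) f u = \sum_u f u.
Proof.
move=> [injB partB].
rewrite -(big_imset (fun A : {set V} => \sum_(u in A) f u))/=; last by move=> ? ? _ _ /injB.
rewrite -(set_partition_big _ partB)/=.
by apply: eq_bigl => u; rewrite inE.
Qed.

(** This is [maximal_inequality] divided by the number of observations: in the bound, [dl] absorbs
    the variances and [U * tb] the coefficients [tau]. *)
Lemma finite_class_deviation d (T : measurableType d) (R : realType)
    (P : probability T R) dZ (Z : measurableType dZ) (V : finType) (e : rel V)
    (X : V -> T -> Z) (F : set (Z -> R)) (U : R) (p : \bar R)
    (M K q : nat) (B : 'I_M -> {set V}) (c : 'I_M -> 'I_K)
    (Q : nat) (pi : 'I_Q -> Z -> R) (k0 : 'I_Q) (g dl tb : R) :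
  (forall u, measurable_fun [set: T] (X u)) ->
  (forall A B : {set V}, (A :&: B)%SET = finset.set0 ->
    gdist_set R e A B = +oo%E ->
    indep_systems P (sigma_field X A) (sigma_field X B)) ->
  F (fun=> 0) -> (forall f, F f -> measurable_fun [set: Z] f) ->
  0 < U -> (forall f z, F f -> `|f z| <= U) -> (1 <= p)%E ->
  (0 < #|V|)%N -> block_partition B -> (forall m, (#|B m| <= q)%N) ->
  (forall k, F (pi k)) ->
  (forall m, Gamma P e X F p (B m) <= g) -> 0 < dl ->
  (taubar P X (cone (range pi)) B c <= tb%:E)%E ->
  exists Psi : T -> R, [/\ P.-integrable [set: T] (EFin \o Psi),
    forall k w, `|#|V|%:R^-1 *
      \sum_u (pi k (X u w) - \int[P]_w' pi k (X u w'))| <= Psi w &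
    \int[P]_w Psi w <= (4 * U * q%:R + 32 * U ^+ 2 * g ^+ 2 / dl) *
      (K%:R * ln (2 * Q%:R) / #|V|%:R) + dl + U * tb].
Proof.
move=> mX Xind F0 F_meas U0 FU p1 V0 partB Bq Fpi Gg dl0 tauB.
set n : R := #|V|%:R.
have n0 : 0 < n by rewrite ltr0n.
have Bn0 m : (0 < #|B m|)%N.
  rewrite lt0n cards_eq0; case: partB => _ /and3P[_ _].
  by apply: contra => /eqP <-; apply/imsetP; exists m.
have [m0 _] : exists m : 'I_M, true.
  have /card_gt0P[u _] := V0; case: partB => _ /and3P[/eqP cov _ _].
  have : u \in finset.cover (B @: 'I_M)%SET by rewrite cov inE.
  by move=> /finset.bigcupP[_ /imsetP[m _ _] _]; exists m.
have q0 : (0 < q)%N by rewrite (leq_trans (Bn0 m0)).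
(* The inverse of [b]. The first summand yields [b * (2 * U * #|B m|) <= 2^-1], the second
   [2 * b * v m <= dl * #|B m|]; a sum serves as a maximum. *)
pose b' := 4 * U * q%:R + 32 * U ^+ 2 * g ^+ 2 / dl.
have b'1 : 4 * U * q%:R <= b'.
  by rewrite lerDl divr_ge0 ?(ltW dl0)// mulr_ge0 ?sqr_ge0// mulr_ge0 ?sqr_ge0.
have b'2 : 32 * U ^+ 2 * g ^+ 2 / dl <= b'.
  by rewrite lerDr mulr_ge0 ?ler0n// mulr_ge0 ?(ltW U0)//.
have b'0 : 0 < b' by apply: lt_le_trans b'1; rewrite !mulr_gt0// ltr0n.
pose b := b'^-1.
have b0 : 0 < b by rewrite invr_gt0.
pose tm m := tau P (@dist_class R Z (cone (range pi)) #|B m|)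
  (sigma_field X (\bigcup_(m' < M | (c m' == c m) && (m' < m)%N) B m')%SET)
  (block_vector X (B m)).
have tm0 m : (0 <= tm m)%E by exact: tau_ge0.
have tmE : taubar P X (cone (range pi)) B c = ((n^-1)%:E * \sum_(m < M) tm m)%E.
  rewrite /taubar; congr (_ * _)%E.
  rewrite [RHS](partition_big c predT)//=; apply: eq_bigr => k _.
  by apply: eq_bigr => m /eqP cm; rewrite /tm cm.
have sumtm : (\sum_(m < M) tm m <= (n * tb)%:E)%E.
  by move: tauB; rewrite tmE lee_pdivrMl.
have tmfin m : tm m \is a fin_num.
  rewrite ge0_fin_numE//; apply: (@le_lt_trans _ _ (n * tb)%:E); last exact: ltey.
  apply: le_trans sumtm; rewrite (bigD1 m)//= leeDl//.
  by apply: sume_ge0 => m' _; exact: tm0.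
pose t m := fine (tm m).
have sumt : \sum_(m < M) t m <= n * tb.
  by rewrite -lee_fin -sumEFin; under eq_bigr do rewrite /t fineK//.
(* A factor 4 from the covariance inequality times a factor 4 from the comparison with [Gamma]. *)
pose v m := 16 * U ^+ 2 * g ^+ 2 * #|B m|%:R.
(* [pi k] divided by [U] has sup norm at most 1, so it belongs to the cone. *)
have hBc k z z' : (`|pi k z - pi k z'|%:E <= U%:E *
    ereal_sup [set `|f z - f z'|%:E | f in cone (range pi)])%E.
  rewrite -lee_pdivrMl// -EFinM -(gtr0_norm (x := U^-1)) ?invr_gt0//.
  rewrite -normrM mulrBr; apply: ereal_sup_ubound.
  exists (U^-1 \*o pi k) => //; exists (pi k), U^-1; split => //.
  - by rewrite invr_gt0.
  - apply: ge_ereal_sup => _ [x _ <-]; rewrite lee_fin /= normrM.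
    by rewrite gtr0_norm ?invr_gt0// ler_pdivrMl// mulr1 FU.
have bU m : b * (2 * U * #|B m|%:R) <= 2^-1.
  rewrite ler_pdivrMl// -ler_pdivrMr// invrK (le_trans _ b'1)//.
  rewrite (_ : 2 * U * #|B m|%:R * 2 = 4 * U * #|B m|%:R); last by ring.
  by rewrite ler_wpM2l ?ler_nat// mulr_ge0// ltW.
have tau_le k m : c m == k -> (tau P (@dist_class R Z (cone (range pi)) #|B m|)
     (sigma_field X (\bigcup_(m' < M | (c m' == k) && (m' < m)%N) B m')%SET)
     (block_vector X (B m)) <= (t m)%:E)%E.
  by move=> /eqP <-; rewrite /t fineK.
have var_le m k : \int[P]_w (block_sum P X pi (B m) k w) ^+ 2 <= v m.
  apply: (le_trans (block_variance_le mX F0 F_meas Xind U0 FU (Fpi k) (Bn0 m))).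
  have := dependence_sum_le_Gamma mX F_meas p1 (Bn0 m) (Gg m).
  move=> /(ler_wpM2l (ler0n R #|B m|)) /(ler_wpM2l (mulr_ge0 (ler0n R 4) (sqr_ge0 U))).
  by move=> /le_trans; apply; rewrite /v le_eqVlt; apply/orP; left; apply/eqP; ring.
have [Psi [iPsi PsiP Psile]] := @maximal_inequality _ T R P _ Z V X 'I_Q pi U
  (cone (range pi)) M K B c t v b mX k0 U0 (fun k => F_meas _ (Fpi k))
  (fun k z => FU _ _ (Fpi k)) hBc b0 bU tau_le var_le.
exists (fun w => n^-1 * Psi w); split.
- exact: (integrableZl measurableT _ iPsi).
- move=> k w; rewrite normrM gtr0_norm ?invr_gt0// ler_pM2l ?invr_gt0//.
  apply: le_trans (PsiP k w); rewrite -(block_partition_sum _ partB).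
  exact: lexx.
rewrite RintegralZl// ler_pdivrMl//; apply: (le_trans Psile).
have sumB : \sum_(m < M) (#|B m|%:R : R) = n.
  rewrite /n -sum1_card natr_sum -(block_partition_sum _ partB).
  by apply: eq_bigr => m _; rewrite -natr_sum sum1_card.
have bdl : b * (32 * U ^+ 2 * g ^+ 2) <= dl.
  by rewrite ler_pdivrMl// -ler_pdivrMr.
have -> : n * (b' * (K%:R * ln (2 * Q%:R) / n) + dl + U * tb) =
    K%:R * (b' * ln (2 * Q%:R)) + (n * dl + U * (n * tb)).
  rewrite !mulrDr addrA [n * (U * _)]mulrCA; congr (_ + _ + _).
  by field; rewrite lt0r_neq0.
rewrite card_ord /b invrK lerD2l big_split/=; apply: lerD; last first.
  by rewrite -mulr_sumr ler_pM2l.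
have -> : \sum_(m < M) 2 * b * v m = n * (b * (32 * U ^+ 2 * g ^+ 2)).
  rewrite -sumB mulr_suml; apply: eq_bigr => m _; rewrite /v; ring.
by rewrite ler_pM2l.
Qed.

(** * Limits and choice of constants *)

Section eventually.
Context (R : realType).

Lemma cvge0_near_lt (u : nat -> \bar R) (eta : R) :
  u n @[n --> \oo] --> 0%E -> 0 < eta -> \forall n \near \oo, (u n < eta%:E)%E.
Proof.
move=> /fine_cvgP[ufin u0] eta0.
apply: filterS2 ufin (cvgr_lt 0 u0 eta eta0) => n nfin /=.
by rewrite -lte_fin fineK.
Qed.

Lemma near_le_cvge0 (u : nat -> \bar R) : (forall n, 0 <= u n)%E ->
  (forall eta : R, 0 < eta -> \forall n \near \oo, (u n <= eta%:E)%E) ->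
  u n @[n --> \oo] --> 0%E.
Proof.
move=> u0 ule; apply/fine_cvgP; split.
  near=> n; rewrite ge0_fin_numE// (@le_lt_trans _ _ 1%:E) ?ltey//.
  by near: n; exact: ule.
apply/cvgr0Pnorm_le => eta eta0; near=> n.
have un : (u n <= eta%:E)%E by near: n; exact: ule.
have nfin : u n \is a fin_num.
  by rewrite ge0_fin_numE// (le_lt_trans un)// ltey.
by rewrite /= ger0_norm ?fine_ge0// -lee_fin fineK.
Unshelve. all: by end_near. Qed.

End eventually.

(** Here the doubly exponential bound on the number of cells becomes the factor [2 ^+ L]; only
    [ln 2 <= 1] and [1 <= 2 ^+ L] are used. *)
Lemma ln_double_le (R : realType) (Q L : nat) : (0 < Q)%N ->
  (Q <= 2 ^ (2 ^ L))%N -> ln (2 * Q%:R) <= 2 * 2 ^+ L :> R.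
Proof.
move=> Q0 QL.
have ln2 : ln 2 <= 1 :> R by have := @le_ln1Dx R 1 ltac:(lra); rewrite -natr1.
have ln20 : 0 <= ln 2 :> R by rewrite ln_ge0// ler1n.
have lnQ : ln Q%:R <= 2 ^+ L * ln 2 :> R.
  apply: (@le_trans _ _ (ln (2 ^+ (2 ^ L)))).
    by rewrite ler_ln ?posrE ?ltr0n ?exprn_gt0// -natrX ler_nat.
  by rewrite lnXn// -[leLHS]mulr_natl natrX.
rewrite lnM ?posrE ?ltr0n//.
have L1 : 1 <= 2 ^+ L :> R by rewrite exprn_ege1// ler1n.
have := ler_wpM2l (le_trans ler01 L1) ln2; lra.
Qed.

Lemma expr2_le_powR_ceil (R : realType) (a : R) (L : nat) : 1 <= a ->
  2 ^+ L <= 2 `^ (Num.ceil (a * L%:R))%:~R :> R.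
Proof.
move=> a1; rewrite -powR_mulrn//; apply: ler_powR; first by rewrite ler1n.
by apply: le_trans (ceil_ge _); rewrite ler_peMl.
Qed.

Lemma taubar_ge0 d (T : measurableType d) (R : realType) (P : probability T R)
    dZ (Z : measurableType dZ) (V : finType) (X : V -> T -> Z)
    (Bc : set (Z -> R)) (M K : nat) (B : 'I_M -> {set V}) (c : 'I_M -> 'I_K) :
  (0 <= taubar P X Bc B c)%E.
Proof.
rewrite mule_ge0 ?lee_fin ?invr_ge0//; apply: sume_ge0 => k _.
by apply: sume_ge0 => m _; exact: tau_ge0.
Qed.

(* [g] stands for the largest Gamma_p(B_m) *)
Lemma rate_le (R : realType) (n q L K Q : nat) (U dl a b g : R) :
  (0 < n)%N -> 0 < U -> 0 < dl -> 1 <= a -> 1 <= b -> 0 <= g ->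
  (0 < Q)%N -> (Q <= 2 ^ (2 ^ L))%N ->
  K%:R * q%:R / n%:R * 2 `^ (Num.ceil (b * L%:R))%:~R <= dl / (16 * U) ->
  Num.sqrt K%:R / Num.sqrt n%:R * g * 2 `^ ((Num.ceil (a * L%:R))%:~R / 2)
    <= dl / (16 * U) ->
  (4 * U * q%:R + 32 * U ^+ 2 * g ^+ 2 / dl) * (K%:R * ln (2 * Q%:R) / n%:R)
    <= dl.
Proof.
move=> n0 U0 dl0 a1 b1 g0 Q0 QL.
set cb := Num.ceil _; set ca := Num.ceil _ => hq hg.
have lnQ : ln (2 * Q%:R) <= 2 * 2 ^+ L :> R by exact: ln_double_le.
have n0' : 0 < n%:R :> R by rewrite ltr0n.
pose y : R := K%:R / n%:R.
have y0 : 0 <= y by rewrite divr_ge0.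
have h1 : y * q%:R * 2 ^+ L <= dl / (16 * U).
  apply: le_trans hq; rewrite /y [K%:R / _ * _]mulrAC.
  by rewrite ler_wpM2l ?expr2_le_powR_ceil// !mulr_ge0// invr_ge0 ltW.
(* Squaring the hypothesis on Gamma turns [K] and [n] under square roots into [y] and removes the
   half in the exponent. *)
have h2 : y * g ^+ 2 * 2 ^+ L <= (dl / (16 * U)) ^+ 2.
  have sq2 : (2 `^ (ca%:~R / 2)) ^+ 2 = 2 `^ ca%:~R :> R.
    by rewrite -powR_mulrn ?powR_ge0// -powRrM divfK// pnatr_eq0.
  have sqy : (Num.sqrt K%:R / Num.sqrt n%:R) ^+ 2 = y.
    by rewrite expr_div_n !sqr_sqrtr.
  apply: (@le_trans _ _ ((Num.sqrt K%:R / Num.sqrt n%:R * g * 2 `^ (ca%:~R / 2)) ^+ 2)).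
    rewrite [leRHS]exprMn sq2 [X in _ <= X * _]exprMn sqy ler_wpM2l ?expr2_le_powR_ceil//.
    by rewrite mulr_ge0// sqr_ge0.
  rewrite lerXn2r// nnegrE; last by rewrite divr_ge0 ?ltW// mulr_gt0.
  by rewrite !mulr_ge0 ?powR_ge0 ?invr_ge0 ?sqrtr_ge0.
have step : (4 * U * q%:R + 32 * U ^+ 2 * g ^+ 2 / dl) * (K%:R * ln (2 * Q%:R) / n%:R)
    <= 8 * U * (y * q%:R * 2 ^+ L) + 64 * U ^+ 2 / dl * (y * g ^+ 2 * 2 ^+ L).
  rewrite (_ : 8 * U * _ + _ = (4 * U * q%:R + 32 * U ^+ 2 * g ^+ 2 / dl) *
    (y * (2 * 2 ^+ L))); last by field; rewrite lt0r_neq0.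
  rewrite ler_wpM2l//; last by rewrite [K%:R * _]mulrC -mulrA mulrC ler_wpM2l.
  by rewrite addr_ge0// ?divr_ge0 ?(ltW dl0)// !mulr_ge0 ?sqr_ge0// ltW.
apply: (le_trans step).
(* The threshold [dl / (16 * U)] leaves [dl / 2 + dl / 4], below [dl]. *)
have e1 : 8 * U * (dl / (16 * U)) = dl / 2 by field; rewrite lt0r_neq0.
have e2 : 64 * U ^+ 2 / dl * (dl / (16 * U)) ^+ 2 = dl / 4.
  by field; rewrite !lt0r_neq0.
have h1' := ler_wpM2l (ltW (mulr_gt0 (ltr0n R 8) U0)) h1.
have c0 : 0 <= 64 * U ^+ 2 / dl by rewrite divr_ge0 ?(ltW dl0)// mulr_ge0 ?sqr_ge0.
have h2' := ler_wpM2l c0 h2.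
rewrite e1 in h1'; rewrite e2 in h2'.
apply: (le_trans (lerD h1' h2')).
by clear -dl0; lra.
Qed.

Theorem theorem3 (R : realType)
  (d : measure_display) (T : measurableType d) (P : probability T R)
  (Z : completePseudoMetricType R) (Z_hausdorff : hausdorff_space Z)
  (Z_separable : exists2 S : set Z, countable S & dense S)
  (N : nat -> finType) (N_card : forall n, #|N n| = n)
  (E : forall n, rel (N n)) (E_sym : forall n, symmetric (E n))
  (X : forall n, N n -> {RV P >-> borel Z})
  (X_indep : forall n (A B : {set N n}), (A :&: B)%SET = finset.set0 ->
     gdist_set R (E n) A B = +oo%E ->
     indep_systems P (sigma_field (X n) A) (sigma_field (X n) B))
  (F : set (borel Z -> R)) (F0 : F (fun=> 0))
  (F_meas : forall f, F f -> measurable_fun [set: borel Z] f)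
  (F_bounded : (ereal_sup [set supnorm f | f in F] < +oo)%E)
  (p : \bar R) (p_ge1 : (1 <= p)%E)
  (M q r : nat -> nat) (B : forall n, 'I_(M n) -> {set N n})
  (B_partition : forall n, block_partition (B n))
  (B_card : forall n, (\max_(m < M n) #|B n m| <= q n)%N)
  (c : forall n, 'I_(M n) -> 'I_(Kcol R (E n) (B n) (r n)))
  (c_proper : forall n, proper_coloring R (E n) (B n) (r n) (c n))
  (L Q : nat -> nat) (C : forall n, 'I_(Q n) -> set (borel Z -> R))
  (C_partition : forall n, partition [set: 'I_(Q n)] (C n) F)
  (C_card : forall n, (Q n <= 2 ^ (2 ^ L n))%N)
  (pi : forall n, 'I_(Q n) -> (borel Z -> R))
  (pi_mem : forall n k, C n k (pi n k))
  (a b : R) (a_ge1 : 1 <= a) (b_ge1 : 1 <= b)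
  (Gamma_cvg :
     Num.sqrt (Kcol R (E n) (B n) (r n))%:R / Num.sqrt n%:R
       * (\big[Num.max/0]_(m < M n) Gamma P (E n) (X n) F p (B n m))
       * 2 `^ ((Num.ceil (a * (L n)%:R))%:~R / 2)
     @[n --> \oo] --> (0 : R))
  (tau_cvg :
     ((((Kcol R (E n) (B n) (r n))%:R * (q n)%:R / n%:R)%:E
        + taubar P (X n) (cone (range (pi n))) (B n) (c n))
       * (2 `^ (Num.ceil (b * (L n)%:R))%:~R)%:E
     @[n --> \oo] --> 0)%E)
  (diam_cvg :
     ((n%:R^-1)%:E * (\sum_(i : N n) outer_expectation P
        (fun w => ereal_sup [set diam (C n k) (X n i w) | k in [set: 'I_(Q n)]]))
     @[n --> \oo] --> 0)%E) :
  forall eps : R, 0 < eps ->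
    (mu_ext P [set w | eps%:E < ereal_sup
        [set `|n%:R^-1 * \sum_(i : N n) (f (X n i w) - fine 'E_P[f \o X n i])|%R%:E
           | f in F]]
     @[n --> \oo] --> 0)%E.
Proof.
move=> eps eps0.
have [U U0 FU] : exists2 U : R, 0 < U & forall f z, F f -> `|f z| <= U.
  have supF f z : F f -> (`|f z|%:E <= ereal_sup [set supnorm f | f in F])%E.
    move=> Ff; apply: (@le_trans _ _ (supnorm f)).
      by apply: ereal_sup_ubound; exists z.
    by apply: ereal_sup_ubound; exists f.
  move: F_bounded supF; case: (ereal_sup _) => [s _ supF| |_ supF]//.
    exists (`|s| + 1) => [|f z Ff]; first by rewrite ltr_wpDl.
    have := supF f z Ff; rewrite lee_fin => /le_trans; apply.
    by rewrite (le_trans (ler_norm s))// lerDl.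
  (* A supremum equal to [-oo] is impossible because the class contains 0. *)
  by have := supF _ point F0; rewrite leeNy_eq.
have mX n i : measurable_fun [set: T] (X n i) by [].
have CF n k f : C n k f -> F f.
  by move=> Cf; have [<- _ _] := C_partition n; exists k.
have Fcov n f : F f -> exists k, C n k f.
  by have [{1}<- _ _] := C_partition n; move=> [k _ Ckf]; exists k.
apply: near_le_cvge0 => [n|eta eta0]; first exact: mu_ext_ge0.
(* Seven shares: three in the mean of [Psi] (logarithmic term, variances, [tau]) and four from the
   diameters. The factor [eps] compensates Markov's inequality. *)
pose dl := eps * eta / 7.
have dl0 : 0 < dl by rewrite divr_gt0// mulr_gt0.
pose dl' := Num.min (dl / (16 * U)) (dl / U).
have dl'0 : 0 < dl' by rewrite lt_min !divr_gt0// mulr_gt0.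
have dl'1 : dl' <= dl / (16 * U) by rewrite ge_min lexx.
have dl'2 : dl' <= dl / U by rewrite ge_min lexx orbT.
have Gamma_near : \forall n \near \oo,
    Num.sqrt (Kcol R (E n) (B n) (r n))%:R / Num.sqrt n%:R
       * (\big[Num.max/0]_(m < M n) Gamma P (E n) (X n) F p (B n m))
       * 2 `^ ((Num.ceil (a * (L n)%:R))%:~R / 2) < dl / (16 * U).
  by apply: (cvgr_lt 0 Gamma_cvg); rewrite divr_gt0// mulr_gt0.
have tau_near := cvge0_near_lt tau_cvg dl'0.
have diam_near := cvge0_near_lt diam_cvg dl0.
near=> n.
have hG : Num.sqrt (Kcol R (E n) (B n) (r n))%:R / Num.sqrt n%:R
    * (\big[Num.max/0]_(m < M n) Gamma P (E n) (X n) F p (B n m))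
    * 2 `^ ((Num.ceil (a * (L n)%:R))%:~R / 2) < dl / (16 * U).
  by near: n.
have ht : ((((Kcol R (E n) (B n) (r n))%:R * (q n)%:R / n%:R)%:E
    + taubar P (X n) (cone (range (pi n))) (B n) (c n))
    * (2 `^ (Num.ceil (b * (L n)%:R))%:~R)%:E < dl'%:E)%E.
  by near: n.
have hd : ((n%:R^-1)%:E * (\sum_(i : N n) outer_expectation P
    (fun w => ereal_sup [set diam (C n k) (X n i w) | k in [set: 'I_(Q n)]]))
    < dl%:E)%E.
  by near: n.
have n0 : (0 < n)%N by near: n; exact: nbhs_infty_gt.
have V0 : (0 < #|N n|)%N by rewrite N_card.
(* The cell of the zero function shows that there is at least one representative. *)
have [k0 _] := Fcov n _ F0.
have Q0 : (0 < Q n)%N by apply: leq_ltn_trans (ltn_ord k0).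
set g := \big[Num.max/0]_(m < M n) _ in hG.
have g0 : 0 <= g by exact: bigmax_ge_id.
have Gg m : Gamma P (E n) (X n) F p (B n m) <= g.
  exact: (le_bigmax (0 : R) (fun m => Gamma P (E n) (X n) F p (B n m)) m).
have Bq m : (#|B n m| <= q n)%N by apply: leq_trans (B_card n); exact: leq_bigmax.
set K := Kcol R (E n) (B n) (r n) in hG ht *.
set tb := taubar _ _ _ _ _ in ht.
have tb0 : (0 <= tb)%E by exact: taubar_ge0.
pose x : R := K%:R * (q n)%:R / n%:R.
pose y : R := 2 `^ (Num.ceil (b * (L n)%:R))%:~R.
have x0 : 0 <= x by rewrite divr_ge0// mulr_ge0.
have y1 : 1 <= y.
  by apply: le_trans (expr2_le_powR_ceil (L n) b_ge1); rewrite exprn_ege1// ler1n.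
have y0 : 0 < y by exact: lt_le_trans y1.
have xtb0 : (0 <= x%:E + tb)%E by rewrite adde_ge0// lee_fin.
have xy : x * y <= dl / (16 * U).
  apply: le_trans dl'1; rewrite -lee_fin; apply: le_trans (ltW ht).
  by rewrite EFinM lee_wpmul2r ?lee_fin ?(ltW y0)// leeDl.
(* The factor [y] is at least 1, so the hypothesis on the product also bounds [tb] alone. *)
have tb_le : (tb <= (dl / U)%:E)%E.
  apply: (@le_trans _ _ dl'%:E); last by rewrite lee_fin.
  apply: le_trans (ltW ht); apply: (@le_trans _ _ (x%:E + tb)%E).
    by rewrite leeDr// lee_fin.
  by rewrite -[leLHS]mule1 lee_wpmul2l// lee_fin.
have [Psi [iPsi PsiP Psile]] := finite_class_deviation k0 (mX n) (@X_indep n) F0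
  F_meas U0 FU p_ge1 V0 (B_partition n) Bq (fun k => CF n k _ (pi_mem n k)) Gg dl0 tb_le.
have rate := rate_le n0 U0 dl0 a_ge1 b_ge1 g0 Q0 (C_card n) xy (ltW hG).
have Psi3 : \int[P]_w Psi w <= 3 * dl.
  apply: (le_trans Psile); rewrite [U * _]mulrC divfK ?lt0r_neq0//.
  rewrite N_card (_ : 3 * dl = dl + dl + dl); last by ring.
  by rewrite !lerD2r.
have := @class_deviation _ T R P _ (borel Z) (N n) (fun i => X n i) F U (Q n) (C n)
  (pi n) k0 Psi (3 * dl) dl eps (mX n) V0 F_meas FU (Fcov n) (CF n) (@pi_mem n) iPsi
  PsiP Psi3 dl0 eps0.
rewrite N_card => /(_ (ltW hd)) /le_trans; apply.
rewrite lee_fin ler_pdivrMl// /dl.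
rewrite (_ : 3 * _ + 4 * _ = eps * eta)//; field.
Unshelve. all: by end_near. Qed.
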